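(* Let $(Q,M)$ be a random pair and let $R$ be a real random variable, independent of $(Q,M)$, satisfying $R\stackrel{d}{=}Q+MR$. Assume that $\mathbb{P}(M\in[0,1))=1$, that $\sup\{x\colon \mathbb{P}(M>x)>0\}=1$, and that $Q=q$ with probability $1$ for a constant $q>0$. Define $f(x)=-x\ln\mathbb{P}(M>1-1/x)$ for $x\geq 1$. (i) If $f\in R(r^\ast)$ for some $r^\ast>1$, then $$\lim_{x\to\infty}\frac{\ln \mathbb{P}(R>x)}{f(x/q)}=-r^{\,r^\ast-1},$$ where $r$ is defined by $1/r+1/r^\ast=1$. (ii) If $f\in\Gamma$, then $$\lim_{x\to\infty}\frac{\ln \mathbb{P}(R>x)}{f(x/q)}=-e.$$ (iii) If $f\in R(1)$ and $f$ is ultimately strictly convex, then $$\lim_{x\to\infty}\frac{\ln \mathbb{P}(R>x)}{f(x/q)}=-1.$$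
   Context: $\stackrel{d}{=}$ denotes equality in distribution. For $\rho\in\mathbb{R}$, $R(\rho)$ (regularly varying functions with index $\rho$) is the class of measurable functions $f$ with positive values such that $\lim_{x\to\infty} f(\lambda x)/f(x)=\lambda^\rho$ for every $\lambda>0$. (Only the behaviour of $f$ for large arguments matters; the function $f$ of the claim need only be positive for large $x$.) $\Gamma$ is the class of nondecreasing, right-continuous functions $f$ on $\mathbb{R}$ for which there exists a measurable function $g\colon\mathbb{R}\to(0,\infty)$ such that $\lim_{x\to\infty} f(x+u g(x))/f(x)=e^u$ for every $u\in\mathbb{R}$. For the function $f$ of the claim, set $f(x)=0$ for $x<1$ when membership in $\Gamma$ is considered. ''Ultimately'' means for large values of the argument: $f$ is ultimately strictly convex if it is strictly convex on $(x_0,\infty)$ for some $x_0$. *)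

(* Defs.v *)
From HB Require Import structures.
From mathcomp Require Import all_boot all_order all_algebra.
From mathcomp Require Import all_classical all_reals all_analysis.

Set Implicit Arguments.
Unset Strict Implicit.
Unset Printing Implicit Defensive.

Import Order.TTheory GRing.Theory Num.Theory.
Import numFieldNormedType.Exports.

Local Open Scope classical_set_scope.
Local Open Scope ring_scope.

(* The laws are compared on measurable sets only: a measure is a total function
   on [set T], and its values on nonmeasurable sets carry no meaning. *)
Definition eq_in_distribution d d' (T : measurableType d)
    (T' : measurableType d') (R : realType) (P : probability T R)
    (X Y : T -> T') : Prop :=
  forall A : set T', measurable A -> P (X @^-1` A) = P (Y @^-1` A).

Definition independent_of_pair d (T : measurableType d) (R : realType)
    (P : probability T R) (X Q M : {RV P >-> R}) : Prop :=
  forall (A : set R) (B : set (R * R)), measurable A -> measurable B ->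
    (P ([set w | A (X w)] `&` [set w | B (Q w, M w)]) =
     P [set w | A (X w)] * P [set w | B (Q w, M w)])%E.

(* Only the behaviour at +oo matters, so positivity is required only there. *)
Definition regularly_varying (R : realType) (rho : R) (f : R -> R) : Prop :=
  [/\ measurable_fun [set: R] f,
      \forall x \near +oo, 0 < f x
    & forall lambda : R, 0 < lambda ->
        f (lambda * x) / f x @[x --> +oo] --> lambda `^ rho].

Definition class_Gamma (R : realType) (f : R -> R) : Prop :=
  [/\ {homo f : x y / x <= y},
      right_continuous f
    & exists g : R -> R,
        [/\ measurable_fun [set: R] g,
            forall x, 0 < g x
          & forall u : R,
              f (x + u * g x) / f x @[x --> +oo] --> expR u]].

Definition ultimately_strictly_convex (R : realType) (f : R -> R) : Prop :=
  exists x0 : R, forall x y t : R, x0 < x -> x0 < y -> x != y -> 0 < t < 1 ->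
    f (t * x + (1 - t) * y) < t * f x + (1 - t) * f y.

(* [ln 0 = 0] in the library: the formula is the intended one only when
   P(M > 1 - 1/x) > 0, which holds for all x >= 1 if sup {x | P(M > x) > 0} = 1.
   The value 0 for x < 1 is the convention under which class_Gamma is tested. *)
Definition tail_rate d (T : measurableType d) (R : realType)
    (P : probability T R) (M : {RV P >-> R}) (x : R) : R :=
  if 1 <= x then - x * ln (fine (ccdf M (1 - 1 / x))) else 0.

(* Main.v *)
Require Import Defs.
From HB Require Import structures.
From mathcomp Require Import all_boot all_order all_algebra.
From mathcomp Require Import all_classical all_reals all_analysis.
From mathcomp Require Import measurable_realfun ring lra.

Set Implicit Arguments.
Unset Strict Implicit.
Unset Printing Implicit Defensive.

Import Order.TTheory GRing.Theory Num.Theory.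
Import numFieldNormedType.Exports.

Local Open Scope classical_set_scope.
Local Open Scope ring_scope.

(* Let D(x) = P(R > q x). A jump from level y to level y + dl requires
   M > 1 - 1/z with z = y / (1 - dl), hence costs f(z)/z, that is f(z)/(z - y)
   per unit of height. Since D(x + 1) is negligible against D(x), upward jumps
   are the only way to a high level, so -ln D has slope about
   min_z f(z)/(z - y), the slope of the tangent through (y, 0) to the graph of
   f. In all three cases f(x + u g(x)) / f(x) tends to some kappa(u): g(x) = x
   and kappa(u) = (1 + u)^rho for R(rho), kappa(u) = e^u for Gamma. Then -ln D
   has slope about A f/g with A = inf_w kappa(w)/w, whereas f grows at the rate
   tau f/g with tau = kappa'(0), so that -ln D / f tends to A / tau. *)

(** * From one-step bounds to the logarithmic tail *)

(** The two halves are not symmetric. A lower bound on [D] needs only one good strategy: repeated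
    jumps with a single, nearly optimal [w]. An upper bound must beat all strategies at once, by
    induction on the level. There the one-step inequality first has [D y] on both sides, through
    jumps that start above [y]; the rapid decay of [D] lets these be absorbed. Tangents are replaced
    by lines of slope slightly below [A * f x / g x] under the graph, and derivatives by finite
    steps [u * g x], with [u] tending to 0 only at the very end. The constants: for index [p > 1],
    [(1 + w)^p / w] has minimum [p * r^(p - 1)] at [w = 1 / (p - 1)], and [tau = p]; for Gamma,
    [exp w / w] has minimum [e] at [w = 1], and [tau = 1]; for index 1, [(1 + w) / w] has infimum 1,
    approached only as [w] grows, and [tau = 1]. *)

Lemma near_pinfty_ex (K : realType) (P : K -> Prop) :
  (\forall x \near +oo, P x) -> exists2 X, 1 <= X & forall x, X <= x -> P x.
Proof.
case=> X [_ PX]; exists (Num.max (X + 1) 1); first by rewrite le_max lexx orbT.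
by move=> x; rewrite ge_max => /andP[Xx _]; apply: PX; lra.
Qed.

Lemma near_pinfty_ge (K : realType) (P : K -> Prop) (X : K) :
  (forall x, X <= x -> P x) -> \forall x \near +oo, P x.
Proof.
by move=> PX; exists X; split=> [|x /ltW]; [exact: num_real|exact: PX].
Qed.

Lemma expRN_le_frac (K : realType) (x : K) : 0 <= x -> expR (- x) <= (1 + x)^-1.
Proof.
by move=> x0; rewrite expRN lef_pV2 ?posrE ?expR_gt0 ?expR_ge1Dx//; lra.
Qed.

Lemma sum_geometric_le2 (K : realFieldType) (r : K) n :
  0 <= r <= 1 / 2 -> \sum_(j < n) r ^+ j <= 2.
Proof.
move=> /andP[r0 r1].
suff : \sum_(j < n) r ^+ j + 2 * r ^+ n <= 2.
  by apply: le_trans; rewrite lerDl mulr_ge0// exprn_ge0.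
elim: n => [|n IH]; first by rewrite big_ord0 expr0; lra.
rewrite big_ord_recr/=; apply: le_trans IH; rewrite -addrA lerD2l exprS.
have := exprn_ge0 n r0; nra.
Qed.

(* The level from which [y] is reached is cut into slices of height [1 / n]; from
   [y - j / n] a factor exceeding [(y - 1) / (y - j / n) = 1 - 1 / z] is needed. *)
Definition one_step_bound (K : realType) (D f : K -> K) (y : K) :=
  forall n, (0 < n)%N ->
    D y <= 2 * \sum_(j < n) D (y - j.+1%:R / n%:R) *
      let z := (y - j%:R / n%:R) / (1 - j%:R / n%:R) in expR (- (f z / z)).

(* The condition on [f] says that the line of slope [(1 + e) * a] through [(x, 0)]
   lies below the graph of [f]. The slices have height [1 / n] with [a / n]
   comparable to [f x / x], so that the sum over slices is geometric even when
   [a] is huge compared with [f x / x]. *)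
Lemma linear_tail_bound (K : realType) (D f : K -> K) (e : K) :
  0 < e ->
  (forall y, 0 < D y) ->
  (forall x y, 1 <= x -> x <= y -> f x / x <= f y / y) ->
  (forall B, \forall x \near +oo, B <= f x / x) ->
  (\forall y \near +oo, one_step_bound D f y) ->
  \forall x \near +oo, forall a b : K, 0 <= a ->
    (forall z : K, x <= z -> (1 + e) * a * (z - x) <= f z) ->
    (forall y : K, x - 1 <= y <= x -> D y <= expR (b - a * y)) ->
    forall y : K, x - 1 <= y -> D y <= expR (b - a * y).
Proof.
move=> e0 Dgt0 phi_nd phi_oo /near_pinfty_ex[X X1 step].
(* This [k] is what the slack [e / 2] can pay for: [(1 + e / 2) * q <= p] and [F <= p] imply
   [q + k * (q + F) <= p]. *)
pose k : K := (e / 2) / (2 + e / 2).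
have k0 : 0 < k by rewrite /k divr_gt0//; lra.
have kE : k * (2 + e / 2) = e / 2 by rewrite /k divfK// lt0r_neq0//; lra.
(* The first term makes the prefactor [exp (a / n - k * F)] at most [exp (-3) <= 1 / 4], the second
   makes the geometric ratio at most [1 / 2] when [n > 1]. The slices then add up to at most
   [2 * (1 / 4) * 2 = 1]. *)
have [Y Y1 FB] := near_pinfty_ex (phi_oo (6 / k + 4 / k ^+ 2)).
apply: (@near_pinfty_ge _ _ (X + Y + 2 * (1 + e) / e)) => x xX a b a0 fge Dx.
have e2 : 0 < 2 * (1 + e) / e by rewrite divr_gt0//; lra.
have x1 : 1 <= x by lra.
have xe : 1 + e <= e / 2 * x.
  have : 2 * (1 + e) / e <= x by lra.
  by rewrite ler_pdivrMr//; nra.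
set F := f x / x.
have {}FB : 6 / k + 4 / k ^+ 2 <= F by apply: FB; lra.
have F1 : 6 <= k * F.
  have : 6 / k <= F.
    by apply: le_trans FB; rewrite lerDl divr_ge0// ?sqr_ge0.
  by rewrite ler_pdivrMr//; nra.
have F2 : 4 <= k ^+ 2 * F.
  have : 4 / k ^+ 2 <= F.
    by apply: le_trans FB; rewrite lerDr divr_ge0// ltW.
  by rewrite ler_pdivrMr ?exprn_gt0//; nra.
have F0 : 0 < F by nra.
have [n n0 [n1 n2]] : exists2 n, (0 < n)%N &
    a * n%:R^-1 <= k * F / 2 /\ (n = 1%N \/ k * F / 4 <= a * n%:R^-1).
  have kF0 : 0 < k * F by rewrite mulr_gt0.
  have q0 : 0 <= 2 * a / (k * F) by rewrite divr_ge0 ?(ltW kF0)//; lra.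
  have /andP[] := truncn_itv q0.
  set m := Num.trunc _ => m1 m2; exists m.+1 => //; split.
    move: m2; rewrite ltr_pdivrMr// => m2.
    rewrite ler_pdivrMr ?ltr0n//; lra.
  case: m m1 {m2} => [|m] m1; [by left|right].
  move: m1; rewrite ler_pdivlMr// => m1; rewrite ler_pdivlMr ?ltr0n//.
  have : m.+2%:R <= 2 * m.+1%:R :> K by rewrite -natrM ler_nat mulnS add2n !ltnS leq_pmull.
  by nra.
have en j : (j < n)%N -> 0 <= (j%:R / n%:R : K) <= 1 - n%:R^-1.
  move=> jn; rewrite divr_ge0//= ler_pdivrMr ?ltr0n// mulrBl mulVf ?pnatr_eq0 -?lt0n//.
  by rewrite mul1r lerBrDr -[1]/1%:R -natrD ler_nat addn1.
have nV : 0 < n%:R^-1 :> K by rewrite invr_gt0 ltr0n.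
have total : 2 * \sum_(j < n) expR (a * n%:R^-1 - k * F - k * a * (j%:R / n%:R)) <= 1.
  under eq_bigr => j _.
    rewrite expRB (_ : k * a * _ = j%:R * (k * (a / n%:R))); last by ring.
    rewrite -expRN -(mulrN j%:R) expRM_natl; over.
  rewrite -mulr_sumr.
  have S2 : \sum_(j < n) expR (- (k * (a / n%:R))) ^+ j <= 2.
    case: n2 => [->|n2]; first by rewrite big_ord1 expr0; lra.
    apply: sum_geometric_le2; rewrite expR_ge0/=.
    apply: le_trans (expRN_le_frac _) _; first by nra.
    by rewrite div1r lef_pV2 ?posrE//; nra.
  have S1 : expR (a / n%:R - k * F) <= 1 / 4.
    apply: (@le_trans _ _ (expR (- 3))); first by rewrite ler_expR; lra.
    by apply: le_trans (expRN_le_frac _) _; rewrite // div1r lef_pV2 ?posrE//; lra.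
  have S0 : 0 <= \sum_(j < n) expR (- (k * (a / n%:R))) ^+ j.
    by apply: sumr_ge0 => j _; rewrite exprn_ge0// expR_ge0.
  by have := expR_gt0 (a / n%:R - k * F); nra.
(* Every slice has its lower end at least [1 / n] below [y], so the bound climbs by [1 / n] per
   induction step. *)
have main i : forall y : K, x - 1 <= y <= x + i%:R / n%:R -> D y <= expR (b - a * y).
  elim: i => [y|i IH y /andP[yx yi]]; first by rewrite mul0r addr0; exact: Dx.
  have [yx'|xy] := leP y x; first by apply: Dx; rewrite yx.
  have Xy : X <= y by lra.
  apply: le_trans (step y Xy n n0) _.
  rewrite -[leRHS]mulr1; apply: le_trans (ler_wpM2l (expR_ge0 _) total).
  rewrite mulrCA ler_pM2l// mulr_sumr; apply: ler_sum => j _.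
  have /andP[j0 j1] := en j (ltn_ord j).
  rewrite -natr1 mulrDl mul1r in yi.
  set dl := j%:R / n%:R in j0 j1 *.
  rewrite /=; set z := (y - dl) / (1 - dl).
  have Dz : D (y - (dl + n%:R^-1)) <= expR (b - a * (y - (dl + n%:R^-1))).
    by apply: IH; apply/andP; split; move: nV yi; lra.
  rewrite -(natr1 j) [(_ + 1) / _]mulrDl mul1r -/dl.
  apply: le_trans (ler_wpM2r (expR_ge0 _) Dz) _.
  rewrite -!expRD ler_expR.
  have d1 : 0 < 1 - dl by lra.
  have zE : z * (1 - dl) = y - dl by rewrite /z divfK// lt0r_neq0.
  have yz : y <= z by rewrite /z ler_pdivlMr//; nra.
  have phiz : F <= f z / z by apply: phi_nd; lra.
  have z0 : 0 < z by lra.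
  (* Since [z - y = dl * (z - 1)], the line is at least [(1 + e) * a * dl * (z - 1)] at [z]; for [x]
     beyond [2 * (1 + e) / e], half of [e] suffices to turn [z - 1] into [z]. *)
  have : (1 + e / 2) * a * dl <= f z / z.
    rewrite ler_pdivlMr//.
    have := fge z (le_trans (ltW xy) yz); apply: le_trans.
    suff : (1 + e / 2) * (dl * z) <= (1 + e) * (z - x).
      by move=> /(ler_wpM2l a0); lra.
    have : (1 + e / 2) * z <= (1 + e) * (z - 1) by nra.
    move=> /(ler_wpM2l j0) ?.
    have : (1 + e) * (dl * (z - 1)) <= (1 + e) * (z - x).
      by apply: ler_wpM2l; lra.
    lra.
  set p := f z / z in phiz *; set q := a * dl => pq.
  have : (1 + e / 2) * q <= p by rewrite /q; lra.
  have -> : k * a * dl = k * q by rewrite /q; ring.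
  have q0 : 0 <= q by rewrite /q mulr_ge0.
  move=> {}pq.
  suff : q + k * (q + F) <= p by rewrite /q; lra.
  have e2' : 0 < 1 + e / 2 by lra.
  rewrite -(ler_pM2l e2').
  have : (1 + e / 2) * (k * (q + F)) <= k * (p + (1 + e / 2) * p).
    rewrite mulrCA; apply: ler_wpM2l; first exact: ltW.
    by have : (1 + e / 2) * F <= (1 + e / 2) * p; [rewrite ler_pM2l|lra].
  have -> : k * (p + (1 + e / 2) * p) = e / 2 * p by rewrite -[in RHS]kE; ring.
  by lra.
move=> y xy.
have [i yi] : exists i : nat, (y - x) * n%:R < i%:R.
  by exists (Num.trunc ((y - x) * n%:R)).+1; exact: truncnS_gt.
apply: (main i); rewrite xy/= -lerBlDl ler_pdivlMr ?ltr0n//; exact: ltW.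
Qed.

Lemma mulr_lt_perturb (K : realFieldType) (a b c : K) :
  0 <= a -> 0 <= b -> a * b < c -> exists2 t, 0 < t & (a + t) * (b + t) < c.
Proof.
move=> a0 b0 abc; set s := (c - a * b) / (2 * (a + b + 1)).
have s0 : 0 < s by rewrite /s divr_gt0//; lra.
have sE : s * (2 * (a + b + 1)) = c - a * b by rewrite /s divfK// lt0r_neq0//; lra.
exists (Num.min 1 s); first by rewrite lt_min s0 ltr01.
have [] := leP 1 s => h; nra.
Qed.

Section tail_asymptotics.
Variables (K : realType) (D f g kappa : K -> K).
Hypothesis D_gt0 : forall x, 0 < D x.
Hypothesis D_le1 : forall x, D x <= 1.
Hypothesis D_noninc : forall x y, x <= y -> D y <= D x.
Hypothesis D_climb : forall y dl : K, 1 <= y -> 0 < dl < 1 ->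
  D y * expR (- (f (y / (1 - dl)) / (y / (1 - dl)))) <= D (y + dl).
Hypothesis D_one_step : \forall y \near +oo, one_step_bound D f y.
Hypothesis f_nd : forall x y, x <= y -> f x <= f y.
Hypothesis phi_nd : forall x y, 1 <= x -> x <= y -> f x / x <= f y / y.
Hypothesis phi_oo : forall B, \forall x \near +oo, B <= f x / x.
Hypothesis g_gt0 : forall x, 1 <= x -> 0 < g x.
Hypothesis fg_cvg :
  forall u : K, 0 < u -> f (x + u * g x) / f x @[x --> +oo] --> kappa u.

Lemma near_ge_of_div B : \forall x \near +oo, B <= f x.
Proof.
have [X X1 fX] := near_pinfty_ex (phi_oo (Num.max B 0)).
apply: (@near_pinfty_ge _ _ X) => x xX; have x1 := le_trans X1 xX.
have := fX _ xX; rewrite ge_max ler_pdivlMr; last lra.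
by rewrite ler_pdivlMr; [move=> /andP[]; nra|lra].
Qed.

Lemma near_ratio_le (u c : K) : 0 < u -> kappa u < c ->
  \forall x \near +oo, f (x + u * g x) <= c * f x.
Proof.
move=> u0 uc; have [X X1 fX] := near_pinfty_ex (cvgr_le _ (fg_cvg u0) _ uc).
have [Y Y1 fY] := near_pinfty_ex (near_ge_of_div 1).
apply: (@near_pinfty_ge _ _ (X + Y)) => x xX.
have /fX : X <= x by lra.
by rewrite ler_pdivrMr//; apply: lt_le_trans (fY _ _); lra.
Qed.

Lemma near_ratio_ge (u c : K) : 0 < u -> c < kappa u ->
  \forall x \near +oo, c * f x <= f (x + u * g x).
Proof.
move=> u0 uc; have [X X1 fX] := near_pinfty_ex (cvgr_ge _ (fg_cvg u0) _ uc).
have [Y Y1 fY] := near_pinfty_ex (near_ge_of_div 1).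
apply: (@near_pinfty_ge _ _ (X + Y)) => x xX.
have /fX : X <= x by lra.
by rewrite ler_pdivlMr//; apply: lt_le_trans (fY _ _); lra.
Qed.

(** Euler steps of the flow [x' = g x]: each multiplies [f] by about [kappa u], so that [f] is
    nearly geometric along the chain. *)
Definition chain (u x : K) (k : nat) : K := iter k (fun x => x + u * g x) x.

Lemma chainS u x k : chain u x k.+1 = chain u x k + u * g (chain u x k).
Proof. by []. Qed.

Lemma chain_ge (u x : K) k : 0 < u -> 1 <= x -> x <= chain u x k.
Proof.
move=> u0 x1; elim: k => [//|k IH].
have := mulr_gt0 u0 (g_gt0 (le_trans x1 IH)).
by rewrite chainS; lra.
Qed.

(** No lower bound on [g] is at hand, so the escape to infinity is read off from [f]: each step
    multiplies it by at least [c > 1], hence [f] is unbounded along the chain, and monotonicity of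
    [f] carries this over to the nodes. *)
Lemma chain_cofinal (u : K) : 0 < u -> 1 < kappa u -> \forall x \near +oo,
  forall y : K, x <= y -> exists k, chain u x k <= y <= chain u x k.+1.
Proof.
move=> u0 ku; pose c := (1 + kappa u) / 2.
have c1 : 1 < c by rewrite /c; lra.
have cu : c < kappa u by rewrite /c; lra.
have [X X1 fX] := near_pinfty_ex (near_ratio_ge u0 cu).
have [Y Y1 fY] := near_pinfty_ex (near_ge_of_div 1).
apply: (@near_pinfty_ge _ _ (X + Y)) => x xXY y xy.
have x1 : 1 <= x by lra.
have fx : 1 <= f x by apply: fY; lra.
have grow k : f x + k%:R * (c - 1) <= f (chain u x k).
  elim: k => [|k IH]; first by rewrite mul0r addr0.
  rewrite chainS; apply: le_trans (fX _ _).
    have kc : 0 <= k%:R * (c - 1) by rewrite mulr_ge0//; lra.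
    by rewrite -natr1 mulrDl mul1r; nra.
  by have := chain_ge k u0 x1; lra.
have ex : exists k, y <= chain u x k.
  exists (Num.trunc ((f y - f x) / (c - 1))).+1.
  set m := _.+1; rewrite leNgt; apply/negP => /ltW /f_nd.
  apply/negP; rewrite -ltNge; apply: lt_le_trans (grow m).
  have := truncnS_gt ((f y - f x) / (c - 1)).
  by rewrite -/m ltr_pdivrMr; lra.
have := ex_minnP ex; case=> -[|k] yk kmin.
  exists 0%N; rewrite xy (le_trans yk)//.
  by rewrite chainS lerDl mulr_ge0 ?(ltW u0)// ltW// g_gt0.
exists k; rewrite yk andbT leNgt; apply/negP => /ltW /kmin.
by rewrite ltnn.
Qed.

(* Steps of height [(z - X) / z] send every level up to [X] below [z]: the cost
   of each is at most [f z / z]. *)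
Lemma lnD_climb (x X z : K) : 1 <= x -> x <= X -> X < z ->
  - ln (D X) <= - ln (D x) + ((X - x) / (z - X) + z^-1) * f z.
Proof.
move=> x1 xX Xz.
have z0 : 0 < z by lra.
pose dl := (z - X) / z.
have dlz : dl * z = z - X by rewrite /dl divfK// lt0r_neq0.
have dl0 : 0 < dl by rewrite /dl divr_gt0//; lra.
have dl1 : dl < 1 by rewrite /dl ltr_pdivrMr//; lra.
have d1 : 0 < 1 - dl by lra.
have fz y : 1 <= y -> y <= X -> D y * expR (- (f z / z)) <= D (y + dl).
  move=> y1 yX; have := @D_climb y dl y1; rewrite dl0 dl1 => /(_ isT).
  apply: le_trans; rewrite ler_pM2l// ler_expR lerN2; apply: phi_nd.
    by rewrite ler_pdivlMr//; lra.
  by rewrite ler_pdivrMr//; nra.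
have iterD k : x + k%:R * dl <= X + dl ->
    D x * expR (- (k%:R * (f z / z))) <= D (x + k%:R * dl).
  elim: k => [_|k IH]; first by rewrite !mul0r oppr0 expR0 mulr1 addr0.
  rewrite -natr1 !mulrDl !mul1r opprD expRD mulrA => kX.
  rewrite [in leRHS]addrA; apply: le_trans (fz _ _ _); last 2 first.
  - by have := ler0n K k; nra.
  - by lra.
  by rewrite ler_pM2r ?expR_gt0// IH//; lra.
have q0 : 0 <= (X - x) / dl by rewrite divr_ge0 ?(ltW dl0)//; lra.
have /andP[] := truncn_itv q0.
set m := Num.trunc _; rewrite ler_pdivlMr// ltr_pdivrMr// => m1 m2.
have DX : D x * expR (- (m.+1%:R * (f z / z))) <= D X.
  apply: le_trans (iterD _ _) _; first by rewrite -natr1; lra.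
  by apply: D_noninc; lra.
have phi0 : 0 <= f z / z.
  have := @D_climb X dl (le_trans x1 xX); rewrite dl0 dl1 => /(_ isT).
  have -> : X / (1 - dl) = z.
    by apply: (mulIf (lt0r_neq0 d1)); rewrite divfK ?lt0r_neq0//; lra.
  move=> h; have : expR (- (f z / z)) <= 1.
    have := D_noninc (_ : X <= X + dl); rewrite lerDl ltW// => /(_ isT) h2.
    by have := le_trans h h2; have := D_gt0 X; nra.
  by rewrite -[leRHS]expR0 ler_expR; lra.
have : ln (D x * expR (- (m.+1%:R * (f z / z)))) <= ln (D X).
  by rewrite ler_ln ?posrE ?mulr_gt0 ?expR_gt0.
rewrite lnM ?posrE ?expR_gt0// expRK => lnD.
(* The summand [z^-1] pays for rounding the number of jumps up. *)
suff : m.+1%:R * (f z / z) <= ((X - x) / (z - X) + z^-1) * f z by lra.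
have -> : ((X - x) / (z - X) + z^-1) * f z = ((X - x) / dl + 1) * (f z / z).
  by rewrite /dl; field; rewrite !lt0r_neq0//; lra.
apply: ler_wpM2r => //; rewrite -natr1 lerD2r ler_pdivlMr//.
Qed.

(** From [x] to [x + u * g x], jumps priced at [z = x + (u + w) * g x] cost about
    [u / w * kappa (u + w) * f x], while [f] gains about [(kappa u - 1) * f x]. The quotient bounds
    [- ln D / f] along the chain; the leading [kappa u] is lost between two nodes. *)
Lemma lnD_le (u w L : K) : 0 < u -> 0 < w -> 1 < kappa u -> 0 < kappa (u + w) ->
  kappa u * (u / w * kappa (u + w) / (kappa u - 1)) < L ->
  \forall y \near +oo, - ln (D y) <= L * f y.
Proof.
move=> u0 w0 ku kw HL.
set B := u / w * kappa (u + w) in HL.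
have B0 : 0 < B by rewrite /B !mulr_gt0// invr_gt0.
have k1 : 0 < kappa u - 1 by lra.
set b1 := B / (kappa u - 1) in HL.
have b10 : 0 < b1 by rewrite divr_gt0.
have b1E : b1 * (kappa u - 1) = B by rewrite /b1 divfK// lt0r_neq0.
have ku0 : 0 <= kappa u by lra.
have [t t0 tL] := mulr_lt_perturb ku0 (ltW b10) HL.
pose beta := (B + (b1 + t) * (kappa u - 1)) / 2.
have betaB : B < beta by rewrite /beta; nra.
have beta2 : beta < (b1 + t) * (kappa u - 1) by rewrite /beta; nra.
have bt0 : 0 < b1 + t by lra.
(* With this [c1], the gain [(c1 - 1) * f x] over one step, times [b1 + t], pays exactly
   [beta * f x], slightly more than the limiting cost [B * f x]. *)
pose c1 := 1 + beta / (b1 + t).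
have c1E : (b1 + t) * (c1 - 1) = beta.
  by rewrite /c1 addrAC subrr add0r mulrC divfK// lt0r_neq0.
have c1k : c1 < kappa u by rewrite -ltrBrDl ltr_pdivrMr// mulrC.
have wu0 : 0 < u / w by rewrite divr_gt0.
pose c3 := (kappa (u + w) + w / u * beta) / 2.
have wuE : u / w * (w / u) = 1 by field; rewrite !lt0r_neq0.
have c3k : kappa (u + w) < c3.
  suff : kappa (u + w) < w / u * beta by rewrite /c3; lra.
  by rewrite -(ltr_pM2l wu0) mulrA wuE mul1r.
have c3b : u / w * c3 < beta.
  rewrite /c3 mulrA mulrDr [u / w * (w / u * _)]mulrA wuE mul1r -/B; lra.
have uw0 : 0 < u + w by lra.
have [X1 X11 HX1] := near_pinfty_ex (near_ratio_ge u0 c1k).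
have [X2 X21 HX2] := near_pinfty_ex (@near_ratio_le u (kappa u + t) u0 ltac:(lra)).
have [X3 X31 HX3] := near_pinfty_ex (near_ratio_le uw0 c3k).
have [X4 X41 HX4] := near_pinfty_ex (chain_cofinal u0 ku).
have [X5 X51 HX5] := near_pinfty_ex (near_ge_of_div 0).
(* Beyond [X6] the rounding term of [lnD_climb], at most [c3 * f x / x], fits into the gap between
   [u / w * c3] and [beta]. *)
pose X6 := c3 / (beta - u / w * c3).
have X60 : 0 < X6 by rewrite /X6 divr_gt0//; lra.
pose x0 := X1 + X2 + X3 + X4 + X5 + X6.
have x01 : 1 <= x0 by rewrite /x0; lra.
have grow k : - ln (D (chain u x0 k)) <=
    - ln (D x0) + (b1 + t) * f (chain u x0 k).
  elim: k => [|k IH].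
    by rewrite lerDl mulr_ge0 ?(ltW bt0)// HX5// /x0 /=; lra.
  have := chain_ge k u0 x01.
  rewrite chainS; set x := chain u x0 k in IH * => x0x.
  have gx : 0 < g x by rewrite g_gt0//; lra.
  have fx : 0 <= f x by apply: HX5; rewrite /x0 in x0x; lra.
  have H1 : c1 * f x <= f (x + u * g x) by apply: HX1; rewrite /x0 in x0x; lra.
  have H3 : f (x + (u + w) * g x) <= c3 * f x by apply: HX3; rewrite /x0 in x0x; lra.
  have := @lnD_climb x (x + u * g x) (x + (u + w) * g x).
  have ug : 0 < u * g x by rewrite mulr_gt0.
  have wg : 0 < w * g x by rewrite mulr_gt0.
  have x1 : 1 <= x by lra.
  have h2 : x <= x + u * g x by lra.
  have h3 : x + u * g x < x + (u + w) * g x by lra.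
  move=> /(_ x1 h2 h3).
  have -> : (x + u * g x - x) / (x + (u + w) * g x - (x + u * g x)) = u / w.
    by field; rewrite !lt0r_neq0//; lra.
  move=> h; apply: le_trans h _.
  suff : (u / w + (x + (u + w) * g x)^-1) * f (x + (u + w) * g x) <= beta * f x.
    move=> h; apply: le_trans (lerD IH h) _.
    rewrite -addrA lerD2l -c1E -mulrA -mulrDr; apply: ler_wpM2l; lra.
  apply: (@le_trans _ _ ((u / w + x^-1) * (c3 * f x))).
    apply: ler_pM => //.
    - by rewrite addr_ge0 ?invr_ge0; lra.
    - by apply: HX5; rewrite /x0 in x0x; lra.
    - by rewrite lerD2l lef_pV2 ?posrE; lra.
  rewrite mulrA; apply: ler_wpM2r => //.
  rewrite mulrDl -lerBrDl mulrC ler_pdivrMr; last lra.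
  rewrite mulrC -ler_pdivrMr; last lra.
  by move: x0x; rewrite /x0 -/X6; lra.
pose s := L - (kappa u + t) * (b1 + t).
have s0 : 0 < s by rewrite /s; lra.
have [X7 X71 HX7] := near_pinfty_ex (near_ge_of_div (- ln (D x0) / s)).
apply: (@near_pinfty_ge _ _ (x0 + X7)) => y yx.
have x0y : x0 <= y by lra.
have [k /andP[ky yk]] := HX4 x0 ltac:(by rewrite /x0; lra) y x0y.
have x0k := chain_ge k u0 x01.
have h1 : - ln (D y) <= - ln (D (chain u x0 k.+1)).
  by rewrite lerN2 ler_ln ?posrE//; exact: D_noninc.
apply: le_trans h1 _; apply: le_trans (grow _) _.
have h2 : f (chain u x0 k.+1) <= (kappa u + t) * f y.
  rewrite chainS; apply: le_trans (HX2 _ _) _; first by move: x0k; rewrite /x0; lra.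
  by rewrite ler_wpM2l ?f_nd//; lra.
have h3 : - ln (D x0) <= s * f y.
  by rewrite -ler_pdivrMl// mulrC HX7//; lra.
have : (b1 + t) * f (chain u x0 k.+1) <= (b1 + t) * ((kappa u + t) * f y).
  by rewrite ler_pM2l.
move: h3; rewrite /s; lra.
Qed.

(* [- ln D] dominates a convex piecewise affine function with nodes on a chain;
   taking the maximum with the previous slope keeps the slopes nondecreasing. *)
Lemma lnD_ge (u c L : K) : 0 < u -> 1 < kappa u -> 0 < c -> 0 < L ->
  L * kappa u * (kappa u - 1) < c * u ->
  (\forall x \near +oo, forall z : K, x <= z ->
     c * (f x / g x) * (z - x) <= f z) ->
  \forall y \near +oo, L * f y <= - ln (D y).
Proof.
move=> u0 ku c0 L0 HL Hc.
have [t t0 ht] : exists2 t, 0 < t & (kappa u + t) * (kappa u - 1 + t) < c * u / L.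
  apply: mulr_lt_perturb; [lra|lra|rewrite ltr_pdivlMr//; lra].
pose c2 := kappa u + t.
have c2k : kappa u < c2 by rewrite /c2; lra.
have {}ht : L * c2 * (c2 - 1) < c * u.
  have -> : c2 - 1 = kappa u - 1 + t by rewrite /c2; ring.
  by move: ht; rewrite ltr_pdivlMr// -/c2; lra.
have c21 : 0 < c2 - 1 by lra.
pose c' := (c + L * c2 * (c2 - 1) / u) / 2.
have Lu : L * c2 * (c2 - 1) / u < c by rewrite ltr_pdivrMr.
have Lu0 : 0 < L * c2 * (c2 - 1) / u by rewrite !mulr_gt0 ?invr_gt0//; lra.
have c'c : c' < c by rewrite /c'; lra.
have c'0 : 0 < c' by rewrite /c'; lra.
have c'L : L * c2 * (c2 - 1) < c' * u by rewrite -ltr_pdivrMr// /c'; lra.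
pose e := c / c' - 1.
have e0 : 0 < e by rewrite subr_gt0 ltr_pdivlMr// mul1r.
have eE : (1 + e) * c' = c by rewrite /e addrC subrK divfK// lt0r_neq0.
have [X1 X11 HX1] := near_pinfty_ex (near_ratio_le u0 c2k).
have [X2 X21 HX2] := near_pinfty_ex Hc.
have [X3 X31 HX3] := near_pinfty_ex
  (linear_tail_bound e0 D_gt0 phi_nd phi_oo D_one_step).
have [X4 X41 HX4] := near_pinfty_ex (chain_cofinal u0 ku).
have [X5 X51 HX5] := near_pinfty_ex (near_ge_of_div 0).
pose x0 := X1 + X2 + X3 + X4 + X5.
have x01 : 1 <= x0 by rewrite /x0; lra.
(* Over one step the affine bound rises by at least [c' * u * f x] and [f] by at most
   [(c2 - 1) * f x]; [C] is the ratio. The final loss of a factor [c2] between nodes still leaves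
   [C / c2 > L]. *)
pose C := c' * u / (c2 - 1).
have CE : C * (c2 - 1) = c' * u by rewrite /C divfK// lt0r_neq0.
have C0 : 0 < C by rewrite /C divr_gt0// mulr_gt0.
pose slope x : K := c' * (f x / g x).
have slope0 x : x0 <= x -> 0 <= slope x.
  move=> x0x; rewrite /slope mulr_ge0 ?(ltW c'0)// divr_ge0//.
    by apply: HX5; rewrite /x0 in x0x; lra.
  by apply/ltW/g_gt0; lra.
have slopeP x z : x0 <= x -> x <= z -> (1 + e) * slope x * (z - x) <= f z.
  move=> x0x xz; rewrite /slope mulrA eE; apply: HX2 => //.
  by rewrite /x0 in x0x; lra.
(* [B] and [a] are value and slope at the [k]-th node of a convex minorant of [- ln D]. The line
   through the node is a bound on all of [y >= x0 - 1], because to its left it lies below the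
   earlier pieces; the unit stretch below [x0] is the initial interval for [linear_tail_bound]. *)
have inv k : exists a B, let x := chain u x0 k in
    [/\ 0 <= a, forall z, x <= z -> (1 + e) * a * (z - x) <= f z, slope x <= a,
        C * (f x - f x0) <= B &
        forall y, x0 - 1 <= y -> D y <= expR (- B - a * (y - x))].
  elim: k => [|k [a [B /=]]].
    exists (slope x0), 0; split => //=.
    - exact: slope0.
    - by move=> z; exact: slopeP.
    - by rewrite subrr mulr0.
    have := HX3 x0; rewrite {1}/x0 => /(_ ltac:(lra) (slope x0) (slope x0 * x0)).
    move=> /(_ (slope0 _ (lexx _)) (slopeP _ ^~ (lexx _))) H y /H h.
    rewrite oppr0 add0r -mulrN opprB mulrBr; apply: h => {y} y /andP[_ yx].
    apply: le_trans (D_le1 _) _; rewrite -expR0 ler_expR subr_ge0.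
    by rewrite ler_wpM2l ?slope0.
  set x := chain u x0 k.
  have x0x : x0 <= x by exact: chain_ge.
  set x' := x + u * g x.
  have gx : 0 < g x by apply: g_gt0; lra.
  have ugx : 0 < u * g x by rewrite mulr_gt0.
  have xx' : x <= x' by rewrite /x'; lra.
  move=> [a0 aV sa CB DB].
  pose a' := Num.max a (slope x').
  have aa' : a <= a' by rewrite /a' le_max lexx.
  have aV' z : x' <= z -> (1 + e) * a' * (z - x') <= f z.
    move=> x'z; rewrite /a'; have [_|_] := leP a (slope x').
      by apply: slopeP => //; lra.
    apply: le_trans (aV z _); last by lra.
    by apply: ler_wpM2l; [rewrite mulr_ge0//|]; lra.
  have a'0 : 0 <= a' by lra.
  exists a', (B + a * (u * g x)); split => //.
  - by rewrite /a' le_max lexx orbT.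
  - apply: le_trans (_ : C * (f x - f x0) + slope x * (u * g x) <= _); last first.
      by apply: lerD => //; rewrite ler_wpM2r// ltW.
    have -> : slope x * (u * g x) = C * ((c2 - 1) * f x).
      by rewrite [RHS]mulrA CE /slope; field; rewrite lt0r_neq0.
    rewrite -mulrDr; apply: ler_wpM2l; first exact: ltW.
    by have := HX1 x; rewrite -/x'; move: x0x; rewrite /x0; lra.
  have E y : - (B + a * (u * g x)) - a' * (y - x') =
     (- B - a * (x' - x) + a' * x') - a' * y by rewrite /x'; ring.
  have low y : x0 - 1 <= y -> y <= x' ->
      D y <= expR ((- B - a * (x' - x) + a' * x') - a' * y).
    move=> xy yx'; apply: le_trans (DB y xy) _; rewrite ler_expR.
    suff : a * (x' - y) <= a' * (x' - y) by lra.
    by apply: ler_wpM2r => //; lra.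
  move=> y xy; rewrite E; have [yx'|x'y] := leP y x'; first exact: low.
  apply: (HX3 x') => //; first by move: x0x; rewrite /x0; lra.
    by move=> z /andP[h1 h2]; apply: low => //; lra.
  by lra.
have [X6 X61 HX6] := near_pinfty_ex (near_ge_of_div (C * f x0 / (C / c2 - L))).
have CL : 0 < C / c2 - L.
  rewrite subr_gt0 ltr_pdivlMr; last lra.
  by rewrite /C ltr_pdivlMr.
apply: (@near_pinfty_ge _ _ (x0 + X6)) => y yx.
have x0y : x0 <= y by lra.
have [k /andP[ky yk]] := HX4 x0 ltac:(by rewrite /x0; lra) y x0y.
have x0k := chain_ge k u0 x01.
have h1 : - ln (D (chain u x0 k)) <= - ln (D y).
  by rewrite lerN2 ler_ln ?posrE//; exact: D_noninc.
apply: le_trans h1; have [a [B [_ _ _ CB DB]]] := inv k.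
have h2 : D (chain u x0 k) <= expR (- B).
  apply: le_trans (DB (chain u x0 k) _) _; first lra.
  by rewrite subrr mulr0 subr0.
have h3 : B <= - ln (D (chain u x0 k)).
  rewrite lerNr -[leRHS]expRK; rewrite ler_ln ?posrE ?expR_gt0//.
apply: le_trans h3; apply: le_trans CB.
have h4 : f y <= c2 * f (chain u x0 k).
  apply: le_trans (f_nd yk) _; rewrite chainS; apply: HX1.
  by move: x0k; rewrite /x0; lra.
have h5 : C * f x0 <= (C / c2 - L) * f y.
  by rewrite -ler_pdivrMl// mulrC; apply: HX6; lra.
have h6 : C / c2 * f y <= C * f (chain u x0 k).
  rewrite mulrAC ler_pdivrMr; last lra.
  by move: h4 => /(ler_wpM2l (ltW C0)); lra.
lra.
Qed.

End tail_asymptotics.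

Section tail_limit.
Variables (K : realType) (D f g kappa : K -> K).
Hypothesis D_gt0 : forall x, 0 < D x.
Hypothesis D_le1 : forall x, D x <= 1.
Hypothesis D_noninc : forall x y, x <= y -> D y <= D x.
Hypothesis D_climb : forall y dl : K, 1 <= y -> 0 < dl < 1 ->
  D y * expR (- (f (y / (1 - dl)) / (y / (1 - dl)))) <= D (y + dl).
Hypothesis D_one_step : \forall y \near +oo, one_step_bound D f y.
Hypothesis f_nd : forall x y, x <= y -> f x <= f y.
Hypothesis phi_nd : forall x y, 1 <= x -> x <= y -> f x / x <= f y / y.
Hypothesis phi_oo : forall B, \forall x \near +oo, B <= f x / x.
Hypothesis g_gt0 : forall x, 1 <= x -> 0 < g x.
Hypothesis fg_cvg :
  forall u : K, 0 < u -> f (x + u * g x) / f x @[x --> +oo] --> kappa u.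

(** For fixed [u] the preceding bounds have the constants [kappa u * (u / w) * kappa (u + w) /
    (kappa u - 1)] and [c * u / (kappa u * (kappa u - 1))]. As [u] tends to [0+] they tend to
    [kappa w / (w * tau)] and [c / tau], with [kappa w / w] and [c] as close to [A] as desired. *)
Lemma tail_limit (A tau : K) : 0 < A -> 0 < tau ->
  (forall u : K, 0 < u -> 1 < kappa u) ->
  (kappa u - 1) / u @[u --> 0^'+] --> tau ->
  (forall w : K, 0 < w -> kappa (u + w) @[u --> 0^'+] --> kappa w) ->
  (forall A', A < A' -> exists2 w, 0 < w & kappa w / w < A') ->
  (forall c : K, 0 < c < A -> \forall x \near +oo, forall z : K, x <= z ->
     c * (f x / g x) * (z - x) <= f z) ->
  ln (D y) / f y @[y --> +oo] --> - (A / tau).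
Proof.
move=> A0 tau0 k1 ktau kw Ainf growth.
have kto1 : kappa u @[u --> 0^'+] --> (1 : K).
  have : (kappa u - 1) / u * u + 1 @[u --> 0^'+] --> tau * 0 + 1.
    apply: cvgD; last exact: cvg_cst.
    apply: cvgM => //; apply: cvg_at_right_filter; exact: cvg_id.
  rewrite mulr0 add0r; apply: cvg_trans; apply: near_eq_cvg.
  by near=> u; rewrite divfK ?subrK// gt_eqF//; near: u; exact: nbhs_right_gt.
apply/cvgrPdist_le => e e0.
have AT : 0 < A / tau by rewrite divr_gt0.
have H1 : \forall y \near +oo, - ln (D y) <= (A / tau + e) * f y.
  have [|w w0 kwA] := Ainf ((A / tau + e) * tau).
    by rewrite mulrDl divfK ?lt0r_neq0// ltrDl mulr_gt0.
  have lim : kappa u * (kappa (u + w) / w * ((kappa u - 1) / u)^-1) @[u --> 0^'+]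
      --> 1 * (kappa w / w * tau^-1).
    apply: cvgM => //; apply: cvgM; last by apply: cvgV => //; exact: lt0r_neq0.
    by apply: cvgM; [exact: kw|exact: cvg_cst].
  have lt : 1 * (kappa w / w * tau^-1) < A / tau + e.
    by rewrite mul1r ltr_pdivrMr.
  have [u [u0 uL]] : exists u, 0 < u /\
      kappa u * (kappa (u + w) / w * ((kappa u - 1) / u)^-1) < A / tau + e.
    near (0 : K)^'+ => u; exists u; split; near: u; first exact: nbhs_right_gt.
    exact: cvgr_lt lim _ lt.
  apply: (lnD_le D_gt0 D_noninc D_climb f_nd phi_nd phi_oo g_gt0 fg_cvg u0 w0) => //.
  - exact: k1.
  - by apply: lt_trans (k1 _ _) => //; lra.
  - suff -> : u / w * kappa (u + w) / (kappa u - 1) =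
        kappa (u + w) / w * ((kappa u - 1) / u)^-1 by [].
    by rewrite invf_div; ring.
have H2 : \forall y \near +oo, (A / tau - e) * f y <= - ln (D y).
  (* The maximum keeps [L] positive when [e] is large. *)
  pose L := Num.max (A / tau - e) (A / tau / 2).
  have L0 : 0 < L by rewrite lt_max (_ : 0 < A / tau / 2) ?orbT//; lra.
  have LA : L * tau < A.
    by rewrite -ltr_pdivlMr// gt_max; apply/andP; split; lra.
  have LT0 : 0 < L * tau by rewrite mulr_gt0.
  pose c := (L * tau + A) / 2.
  have lim : L * kappa u * ((kappa u - 1) / u) @[u --> 0^'+] --> L * 1 * tau.
    by apply: cvgM => //; apply: cvgM => //; exact: cvg_cst.
  have lt : L * 1 * tau < c by rewrite /c; lra.
  have [u [u0 uL]] : exists u, 0 < u /\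
      L * kappa u * ((kappa u - 1) / u) < c.
    near (0 : K)^'+ => u; exists u; split; near: u; first exact: nbhs_right_gt.
    exact: cvgr_lt lim _ lt.
  have [X1 _ HX1] := near_pinfty_ex (near_ge_of_div phi_oo 0).
  have [X2 _ HX2] : exists2 X, 1 <= X & forall y, X <= y -> L * f y <= - ln (D y).
    apply: near_pinfty_ex.
    apply: (lnD_ge D_gt0 D_le1 D_noninc D_one_step f_nd phi_nd phi_oo g_gt0 fg_cvg u0 _ (c:=c)) => //.
    - exact: k1.
    - by rewrite /c; lra.
    - by move: uL; rewrite mulrA ltr_pdivrMr.
    - by apply: growth; rewrite /c; apply/andP; split; lra.
  apply: (@near_pinfty_ge _ _ (Num.max X1 X2)) => y.
  rewrite ge_max => /andP[/HX1 f0 /HX2]; apply: le_trans.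
  by apply: ler_wpM2r => //; rewrite /L le_max lexx.
have H3 := near_ge_of_div phi_oo 1.
near=> y.
have f1 : 1 <= f y by near: y.
have h1 : - ln (D y) <= (A / tau + e) * f y by near: y.
have h2 : (A / tau - e) * f y <= - ln (D y) by near: y.
have f0 : 0 < f y by lra.
rewrite -opprD normrN ler_norml; apply/andP; split.
  by rewrite -lerBlDl ler_pdivlMr//; lra.
by rewrite -lerBrDl ler_pdivrMr//; lra.
Unshelve. all: by end_near.
Qed.

End tail_limit.

(** * Lines below the graph of f *)

Section growth.
Variables (K : realType) (f g kappa : K -> K).
Hypothesis f_nd : forall x y, x <= y -> f x <= f y.
Hypothesis phi_oo : forall B, \forall x \near +oo, B <= f x / x.
Hypothesis g_gt0 : forall x, 1 <= x -> 0 < g x.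
Hypothesis fg_cvg :
  forall u : K, 0 < u -> f (x + u * g x) / f x @[x --> +oo] --> kappa u.

(** Finitely many limits on a grid of mesh [et] in [[0, S]] suffice, since [f] is monotone in
    between. The mesh is such that [c * et = (1 - c / A) / 2], so rounding up to the next grid point
    is covered by the gap between [c] and [A]. *)
Lemma growth_near (A c S : K) : 0 < c < A ->
  (forall w : K, 0 < w -> 1 <= kappa w /\ A * w <= kappa w) ->
  \forall x \near +oo, forall z : K, x <= z <= x + S * g x ->
    c * (f x / g x) * (z - x) <= f z.
Proof.
move=> /andP[c0 cA] kA.
have A0 : 0 < A by lra.
pose et := (1 - c / A) / (c + c).
have cA1 : c / A < 1 by rewrite ltr_pdivrMr// mul1r.
have cA0 : 0 < c / A by rewrite divr_gt0.
have cAE : c / A * A = c by rewrite divfK// lt0r_neq0.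
have et0 : 0 < et by rewrite /et divr_gt0//; lra.
have etE : et * (c + c) = 1 - c / A by rewrite /et divfK// lt0r_neq0//; lra.
pose N := (Num.trunc (S / et)).+1.
have H (i : 'I_N) : \forall x \near +oo,
    c * (i.+1%:R * et) * f x <= f (x + i%:R * et * g x).
  have [X X1 fX] := near_pinfty_ex (near_ge_of_div phi_oo 0).
  case: i => -[|i] iN /=.
    apply: (@near_pinfty_ge _ _ X) => x /fX f0.
    by rewrite !mul0r addr0 mul1r -[leRHS]mul1r ler_wpM2r//; lra.
  have w0 : 0 < i.+1%:R * et by rewrite mulr_gt0.
  apply: (near_ratio_ge phi_oo fg_cvg w0).
  rewrite -natr1 mulrDl mul1r mulrDr.
  have [k1 kw] := kA _ w0.
  have : c / A * (A * (i.+1%:R * et)) <= c / A * kappa (i.+1%:R * et).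
    by rewrite ler_pM2l.
  by rewrite mulrA cAE; nra.
have [X X1 HX] := near_pinfty_ex (filter_forall _ H).
have [Y Y1 fY] := near_pinfty_ex (near_ge_of_div phi_oo 0).
apply: (@near_pinfty_ge _ _ (X + Y)) => x xXY z /andP[xz zS].
have gx : 0 < g x by apply: g_gt0; lra.
have q0 : 0 <= (z - x) / g x / et by rewrite divr_ge0 ?(ltW et0)// divr_ge0 ?(ltW gx)// subr_ge0.
have /andP[] := truncn_itv q0; set i := Num.trunc _ => i1 i2.
have iN : (i < N)%N.
  rewrite ltnS; apply: le_truncn; rewrite ler_pM2r ?invr_gt0//.
  by rewrite ler_pdivrMr//; lra.
have /(_ (Ordinal iN))/= := HX x ltac:(lra).
have fx : 0 <= f x by apply: fY; lra.
rewrite ler_pdivlMr// ler_pdivlMr// in i1.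
rewrite ltr_pdivrMr// ltr_pdivrMr// in i2.
move=> h; apply: (@le_trans _ _ (c * (i.+1%:R * et) * f x)).
  rewrite (_ : c * (f x / g x) * (z - x) = c * ((z - x) / g x) * f x); last ring.
  apply: ler_wpM2r => //; apply: ler_wpM2l; first exact: ltW.
  by rewrite ler_pdivrMr// ltW.
by apply: le_trans h _; apply: f_nd; lra.
Qed.

End growth.

(** [S] is so large that [c * (1 + S) < A * S], hence [f z / z >= c * (f x / x)] at
    [z = (1 + S) * x]. Beyond that point monotonicity of [f z / z] takes over; up to it,
    [growth_near] applies. *)
Lemma growth_regularly_varying (K : realType) (f : K -> K) (p A c : K) :
  (forall x y, x <= y -> f x <= f y) ->
  (forall x y, 1 <= x -> x <= y -> f x / x <= f y / y) ->
  (forall B, \forall x \near +oo, B <= f x / x) ->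
  (forall u : K, 0 < u -> f (x + u * x) / f x @[x --> +oo] --> (1 + u) `^ p) ->
  (forall w : K, 0 < w -> 1 <= (1 + w) `^ p /\ A * w <= (1 + w) `^ p) ->
  0 < c < A ->
  \forall x \near +oo, forall z : K, x <= z -> c * (f x / x) * (z - x) <= f z.
Proof.
move=> f_nd phi_nd phi_oo f_cvg kA cA; have /andP[c0 cA'] := cA.
pose S := c / (A - c) + 1.
have S0 : 0 < S by rewrite /S addr_gt0// divr_gt0//; lra.
have SA : c < S * (A - c) by rewrite /S mulrDl mul1r divfK ?lt0r_neq0//; lra.
have cS : c * (1 + S) < (1 + S) `^ p by have [_ h] := kA S S0; apply: lt_le_trans h; lra.
have g0 (x : K) : 1 <= x -> 0 < x by lra.
have [X1 X11 HX1] := near_pinfty_ex (near_ratio_ge phi_oo f_cvg S0 cS).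
have [X2 X21 HX2] := near_pinfty_ex (growth_near f_nd phi_oo g0 f_cvg S cA kA).
have [X3 X31 HX3] := near_pinfty_ex (near_ge_of_div phi_oo 0).
apply: (@near_pinfty_ge _ _ (X1 + X2 + X3)) => x xX z xz.
have [zS|Sz] := leP z (x + S * x); first by apply: HX2; [lra|rewrite xz].
have fx : 0 <= f x by apply: HX3; lra.
have x0 : 0 < x by lra.
have z0 : 0 < z by lra.
have Sx : 0 < x + S * x by rewrite addr_gt0// mulr_gt0.
have h1 : c * (1 + S) * f x <= f (x + S * x) by apply: HX1; lra.
have h2 : f (x + S * x) / (x + S * x) <= f z / z.
  by apply: phi_nd; [nra|exact: ltW].
have h3 : c * (f x / x) <= f z / z.
  apply: le_trans h2; rewrite ler_pdivlMr//.
  rewrite (_ : c * (f x / x) * (x + S * x) = c * (1 + S) * f x)//.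
  by field; rewrite lt0r_neq0.
rewrite ler_pdivlMr// in h3; apply: le_trans h3.
by apply: ler_wpM2l; [rewrite mulr_ge0 ?divr_ge0//; lra|lra].
Qed.

Section growth_gamma.
Variables (K : realType) (f g : K -> K).
Hypothesis f_nd : forall x y, x <= y -> f x <= f y.
Hypothesis phi_oo : forall B, \forall x \near +oo, B <= f x / x.
Hypothesis g_gt0 : forall x, 1 <= x -> 0 < g x.
Hypothesis fg_cvg :
  forall u : K, 0 < u -> f (x + u * g x) / f x @[x --> +oo] --> expR u.

(* Otherwise [f] would gain more than a factor [exp (2 + e)] in two steps of the
   chain, each of which multiplies it by about [exp 1]. *)
Lemma gamma_self_neglecting (e : K) : 0 < e ->
  \forall x \near +oo, g (x + g x) <= (1 + e) * g x.
Proof.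
move=> e0; pose c1 : K := expR (1 + e / 3).
have c1k : expR 1 < c1 by rewrite ltr_expR; lra.
have c2k : expR (2 + e * (5 / 6)) < expR (2 + e) by rewrite ltr_expR; lra.
have e2 : 0 < 2 + e by lra.
have [X1 X11 HX1] := near_pinfty_ex (near_ratio_le phi_oo fg_cvg ltr01 c1k).
have [X2 X21 HX2] := near_pinfty_ex (near_ratio_ge phi_oo fg_cvg e2 c2k).
have [X3 X31 HX3] := near_pinfty_ex (near_ge_of_div phi_oo 1).
apply: (@near_pinfty_ge _ _ (X1 + X2 + X3)) => x xX.
rewrite leNgt; apply/negP => gg.
have gx : 0 < g x by apply: g_gt0; lra.
have c10 : 0 <= c1 by exact: expR_ge0.
have h1 : f (x + g x) <= c1 * f x by have := HX1 x ltac:(lra); rewrite mul1r.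
have h2 : f (x + g x + g (x + g x)) <= c1 * f (x + g x).
  by have := HX1 (x + g x) ltac:(lra); rewrite mul1r.
have h3 := HX2 x ltac:(lra).
have h4 : f (x + (2 + e) * g x) <= f (x + g x + g (x + g x)) by apply: f_nd; lra.
have h5 : c1 * f (x + g x) <= c1 * (c1 * f x) by exact: ler_wpM2l.
have fx : 1 <= f x by apply: HX3; lra.
have : expR (2 + e * (5 / 6)) * f x <= c1 * c1 * f x by lra.
by rewrite ler_pM2r; [rewrite /c1 -expRD ler_expR; lra|lra].
Qed.

(* Far from [x] the bound is carried along the chain [x + g x]: [f] doubles at
   each step while [g] grows at most by a factor [4 / 3]. *)
Lemma growth_gamma (c : K) : 0 < c < expR 1 ->
  \forall x \near +oo, forall z : K, x <= z ->
    c * (f x / g x) * (z - x) <= f z.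
Proof.
move=> cA; have /andP[c0 cA'] := cA.
have kA (w : K) : 0 < w -> 1 <= expR w /\ expR 1 * w <= expR w.
  move=> w0; split; first by rewrite -expR0 ler_expR ltW.
  rewrite -[in leRHS](subrK 1 w) addrC expRD ler_pM2l ?expR_gt0//.
  by have := expR_ge1Dx (w - 1); lra.
have e12 : 2 < expR 1 :> K by have := @expR_gt1Dx K 1 (oner_neq0 _); lra.
have e13 : 0 < 1 / 3 :> K by lra.
have e11 : 1 < expR 1 :> K by lra.
have [X1 X11 HX1] := near_pinfty_ex (near_ratio_ge phi_oo fg_cvg ltr01 e12).
have [X2 X21 HX2] := near_pinfty_ex (growth_near f_nd phi_oo g_gt0 fg_cvg 3 cA kA).
have [X3 X31 HX3] := near_pinfty_ex (gamma_self_neglecting e13).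
have [X4 X41 HX4] := near_pinfty_ex (near_ge_of_div phi_oo 0).
have [X5 X51 HX5] := near_pinfty_ex (chain_cofinal f_nd phi_oo g_gt0 fg_cvg ltr01 e11).
have main k : forall x z : K, X1 + X2 + X3 + X4 <= x -> x <= z ->
    z <= chain g 1 x k -> c * (f x / g x) * (z - x) <= f z.
  elim: k => [|k IH] x z xX xz zk.
    have {zk} -> : z = x by apply/eqP; rewrite eq_le xz zk.
    by rewrite subrr mulr0; apply: HX4; lra.
  have gx : 0 < g x by apply: g_gt0; lra.
  (* The ratio [f / g] gains a factor [2 / (4 / 3) = 3 / 2] by moving from [x] to [x + g x]; this
     outweighs the shortening of [z - x] by [g x] exactly when [z - x >= 3 * g x]. *)
  have [zS|Sz] := leP z (x + 3 * g x); first by apply: HX2; [lra|rewrite xz].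
  move: zk; rewrite /chain iterSr mul1r -/(chain g 1 (x + g x) k) => zk.
  have gx' : 0 < g (x + g x) by apply: g_gt0; lra.
  apply: le_trans (IH (x + g x) z _ _ zk); [|lra|lra].
  have h1 : 2 * f x <= f (x + g x) by have := HX1 x ltac:(lra); rewrite mul1r.
  have h2 : g (x + g x) <= (1 + 1 / 3) * g x by apply: HX3; lra.
  have fx : 0 <= f x by apply: HX4; lra.
  have h3 : f x / g x * (3 / 2) <= f (x + g x) / g (x + g x).
    rewrite ler_pdivlMr//.
    have : f x / g x * g (x + g x) <= f x / g x * ((1 + 1 / 3) * g x).
      by apply: ler_wpM2l h2; rewrite divr_ge0// ltW.
    rewrite (_ : f x / g x * ((1 + 1 / 3) * g x) = (1 + 1 / 3) * f x); first lra.
    by field; rewrite lt0r_neq0.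
  rewrite -2!(mulrA c) ler_pM2l//.
  have h4 : 0 <= z - (x + g x) by lra.
  apply: le_trans (ler_wpM2r h4 h3).
  rewrite -[leRHS]mulrA; apply: ler_wpM2l; last by lra.
  by rewrite divr_ge0// ltW.
apply: (@near_pinfty_ge _ _ (X1 + X2 + X3 + X4 + X5)) => x xX z xz.
have [k /andP[_ zk]] := HX5 x ltac:(lra) z xz.
by apply: main zk => //; lra.
Qed.

End growth_gamma.

(** * Power and exponential [kappa] *)

Lemma is_derive_right_quotient (K : realType) (h : K -> K) (x dh : K) :
  is_derive x 1 h dh -> (h (x + u) - h x) / u @[u --> 0^'+] --> dh.
Proof.
move=> [dx <-]; move/cvg_ex : (dx) => [l hl].
rewrite /derive (cvg_lim _ hl)//.
have : u^-1 *: (h (u *: 1 + x) - h x) @[u --> 0^'+] --> l.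
  exact: cvg_dnbhs_at_right hl.
apply: cvg_trans; apply: near_eq_cvg; near=> u.
by rewrite /GRing.scale/= mulr1 mulrC (addrC u).
Unshelve. all: by end_near.
Qed.

Lemma is_derive_cvg_right (K : realType) (h : K -> K) (x dh : K) :
  is_derive x 1 h dh -> h (x + u) @[u --> 0^'+] --> h x.
Proof.
move=> [dx _]; apply: cvg_at_right_filter.
have /differentiable_continuous hc : differentiable h x by exact/derivable1_diffP.
have lim : x + u @[u --> (0 : K)] --> x.
  by rewrite -[X in _ --> X]addr0; apply: cvgD; [exact: cvg_cst|exact: cvg_id].
exact: (@cvg_comp _ _ _ (fun u => x + u) h _ _ _ lim hc).
Qed.

Section tail_limits.
Variables (K : realType) (D f : K -> K).
Hypothesis D_gt0 : forall x, 0 < D x.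
Hypothesis D_le1 : forall x, D x <= 1.
Hypothesis D_noninc : forall x y, x <= y -> D y <= D x.
Hypothesis D_climb : forall y dl : K, 1 <= y -> 0 < dl < 1 ->
  D y * expR (- (f (y / (1 - dl)) / (y / (1 - dl)))) <= D (y + dl).
Hypothesis D_one_step : \forall y \near +oo, one_step_bound D f y.
Hypothesis f_nd : forall x y, x <= y -> f x <= f y.
Hypothesis phi_nd : forall x y, 1 <= x -> x <= y -> f x / x <= f y / y.
Hypothesis phi_oo : forall B, \forall x \near +oo, B <= f x / x.

Lemma tail_limit_regularly_varying (p A : K) : 0 < A -> 1 <= p ->
  (forall lambda : K, 0 < lambda ->
    f (lambda * x) / f x @[x --> +oo] --> lambda `^ p) ->
  (forall w : K, 0 < w -> A * w <= (1 + w) `^ p) ->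
  (forall A', A < A' -> exists2 w : K, 0 < w & (1 + w) `^ p / w < A') ->
  ln (D y) / f y @[y --> +oo] --> - (A / p).
Proof.
move=> A0 p1 f_cvg Aw Ainf.
have p0 : 0 < p by lra.
have g0 (x : K) : 1 <= x -> 0 < x by lra.
have f_cvg' (u : K) : 0 < u -> f (x + u * x) / f x @[x --> +oo] --> (1 + u) `^ p.
  move=> u0; have u1 : 0 < 1 + u by lra.
  apply: cvg_trans (f_cvg _ u1); apply: near_eq_cvg; near=> x.
  by rewrite /= mulrDl mul1r.
have k1 (w : K) : 0 < w -> 1 < (1 + w) `^ p.
  move=> w0; apply: lt_le_trans (le1r_powR _ p1); lra.
apply: (@tail_limit K D f id (fun u => (1 + u) `^ p)) => //.
- have := is_derive_right_quotient (is_derive1_powR p (@ltr01 K)).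
  by rewrite powR1 mulr1.
- move=> w w0; have w1 : 0 < 1 + w by lra.
  have := is_derive_cvg_right (is_derive1_powR p w1).
  apply: cvg_trans; apply: near_eq_cvg; near=> u.
  by rewrite /= -addrA (addrC w).
- move=> c cA.
  apply: (growth_regularly_varying f_nd phi_nd phi_oo f_cvg' _ cA) => w w0.
  by split; [exact/ltW/k1|exact: Aw].
Unshelve. all: by end_near.
Qed.

Lemma tail_limit_gamma (g : K -> K) : (forall x, 0 < g x) ->
  (forall u : K, f (x + u * g x) / f x @[x --> +oo] --> expR u) ->
  ln (D y) / f y @[y --> +oo] --> - expR 1.
Proof.
move=> g0 f_cvg.
have f_cvg' (u : K) : 0 < u -> f (x + u * g x) / f x @[x --> +oo] --> expR u.
  by move=> _; exact: f_cvg.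
have g1 (x : K) : 1 <= x -> 0 < g x by [].
rewrite -[expR 1]divr1.
apply: (@tail_limit K D f g expR) => //.
- by move=> u u0; rewrite -expR0 ltr_expR.
- have := is_derive_right_quotient (is_derive_expR (0 : K)).
  rewrite expR0; apply: cvg_trans; apply: near_eq_cvg; near=> u.
  by rewrite /= add0r.
- move=> w w0; have := is_derive_cvg_right (is_derive_expR w).
  apply: cvg_trans; apply: near_eq_cvg; near=> u.
  by rewrite /= addrC.
- by move=> A' hA; exists 1; rewrite ?divr1.
- by move=> c; exact: growth_gamma.
Unshelve. all: by end_near.
Qed.

End tail_limits.

Lemma conjugate_exponent (K : realType) (p r : K) :
  1 < p -> 1 / r + 1 / p = 1 -> 0 < r /\ (p - 1) * r = p.
Proof.
rewrite !div1r => p1 pr; have p0 : 0 < p by lra.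
have r0 : 0 < r.
  rewrite -invr_gt0; have : p^-1 < 1 by rewrite invf_lt1.
  by lra.
split=> //; have : (r^-1 + p^-1) * (r * p) = r * p by rewrite pr mul1r.
have -> : (r^-1 + p^-1) * (r * p) = p + r by field; rewrite !lt0r_neq0.
by lra.
Qed.

(* Young's inequality for [1 + w] and [r `^ (p - 1)]; equality holds at [1 + w = r]. *)
Lemma powR_ge_linear (K : realType) (p r w : K) :
  1 < p -> 1 / r + 1 / p = 1 -> 0 < w ->
  p * r `^ (p - 1) * w <= (1 + w) `^ p.
Proof.
move=> p1 rp w0; have [r0 prE] := conjugate_exponent p1 rp.
have p0 : 0 < p by lra.
have rp' : p^-1 + r^-1 = 1 by move: rp; rewrite !div1r addrC.
have w1 : 0 <= 1 + w by lra.
have := conjugate_powR w1 (powR_ge0 r (p - 1)) p0 r0 rp'.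
rewrite -powRrM prE -(mulr_powRB1 (ltW r0) p0) (mulrC r) mulfK ?lt0r_neq0//.
rewrite mulrDl mul1r addrC lerD2r => h.
by rewrite -mulrA mulrC -ler_pdivlMr// mulrC.
Qed.

Lemma powR_linear_eq (K : realType) (p r : K) :
  1 < p -> 1 / r + 1 / p = 1 ->
  (1 + (p - 1)^-1) `^ p / (p - 1)^-1 = p * r `^ (p - 1).
Proof.
move=> p1 rp; have [r0 prE] := conjugate_exponent p1 rp.
have q0 : 0 < p - 1 by lra.
have p0 : 0 < p by lra.
have -> : 1 + (p - 1)^-1 = r.
  by apply: (mulfI (lt0r_neq0 q0)); rewrite prE mulrDr mulfV ?lt0r_neq0//; lra.
by rewrite invrK -(mulr_powRB1 (ltW r0) p0) mulrAC (mulrC r) prE.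
Qed.

(** * The tail of the perpetuity *)

Section probability_aux.
Context d (T : measurableType d) (K : realType) (P : probability T K).
Implicit Types A B C N : set T.

Definition prob (A : set T) : K := fine (P A).

Lemma prob_ge0 A : 0 <= prob A.
Proof. by rewrite fine_ge0. Qed.

Lemma probE A : measurable A -> (prob A)%:E = P A.
Proof. by move=> mA; rewrite fineK// fin_num_measure. Qed.

Lemma prob_le1 A : measurable A -> prob A <= 1.
Proof. by move=> mA; rewrite -lee_fin probE//; exact: probability_le1. Qed.

Lemma prob_le A B : measurable A -> measurable B -> A `<=` B ->
  prob A <= prob B.
Proof.
by move=> mA mB AB; rewrite -lee_fin !probE//; apply: le_measure; rewrite ?inE.
Qed.

Lemma prob_setC A : measurable A -> prob (~` A) = 1 - prob A.
Proof.
move=> mA; apply: EFin_inj; rewrite probE ?EFinB ?probE//; last exact: measurableC.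
by rewrite probability_setC.
Qed.

Lemma prob_leU_as N A B C : measurable N -> measurable A -> measurable B ->
  measurable C -> P N = 1%E -> A `&` N `<=` B `|` C -> prob A <= prob B + prob C.
Proof.
move=> mN mA mB mC PN AB; rewrite -lee_fin EFinD !probE//.
have PN0 : P (~` N) = 0%E by rewrite probability_setC// PN subee.
apply: (@le_trans _ _ (P ((B `|` C) `|` ~` N))).
  apply: le_measure; rewrite ?inE//.
    by apply: measurableU; [exact: measurableU|exact: measurableC].
  move=> w Aw; have [Nw|Nw] := pselect (N w); last by right.
  by left; apply: AB.
apply: (@le_trans _ _ (P (B `|` C) + P (~` N))%E).
  by apply: measureU2; [exact: measurableU|exact: measurableC].
by rewrite PN0 adde0; exact: measureU2.
Qed.

Lemma prob_le_as N A B : measurable N -> measurable A -> measurable B ->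
  P N = 1%E -> A `&` N `<=` B -> prob A <= prob B.
Proof.
move=> mN mA mB PN AB.
have := @prob_leU_as N A B set0 mN mA mB measurable0 PN.
by rewrite setU0 (_ : prob set0 = 0) ?addr0 => [/(_ AB)|]//; rewrite /prob measure0.
Qed.

Lemma measurable_set_lt (f g : T -> K) : measurable_fun setT f ->
  measurable_fun setT g -> measurable [set w | f w < g w].
Proof.
move=> mf mg; have := measurable_fun_ltr mf mg.
move=> /(_ measurableT [set true] I); rewrite setTI.
by congr measurable; apply/seteqP; split => w /=.
Qed.

Lemma measurable_set01 (f : T -> K) : measurable_fun setT f ->
  measurable [set w | 0 <= f w < 1].
Proof.
move=> mf; rewrite (_ : [set w | _] = f @^-1` `[0, 1[).
  by rewrite -[X in measurable X]setTI; exact: mf.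
by apply/seteqP; split => w /=; rewrite in_itv.
Qed.

End probability_aux.

Lemma fine_ccdf d (T : measurableType d) (K : realType) (P : probability T K)
  (X : {RV P >-> K}) t : fine (ccdf X t) = prob P [set w | t < X w].
Proof.
rewrite /ccdf /prob /distribution /pushforward; congr (fine (P _)).
by apply/seteqP; split => w /=; rewrite in_itv/= andbT.
Qed.

(** * The rate function of [M] *)

Section factor_tail.
Context d (T : measurableType d) (K : realType) (P : probability T K).
Variable M : {RV P >-> K}.
Hypothesis M01 : P [set w | 0 <= M w < 1] = 1%E.
Hypothesis supM : sup [set x : K | (0 < ccdf M x)%E] = 1.

Definition factor_tail (t : K) : K := prob P [set w | t < M w].
Local Notation S := factor_tail.
Local Notation f := (tail_rate M).

Let mMlt t : measurable [set w | t < M w].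
Proof. exact: measurable_set_lt. Qed.

Lemma factor_tail_noninc s t : s <= t -> S t <= S s.
Proof.
move=> st; apply: prob_le => // w /=; exact: le_lt_trans.
Qed.

Lemma factor_tail_gt0 t : t < 1 -> 0 < S t.
Proof.
move=> t1.
(* A set without supremum has [sup] equal to 0 by default, so the value 1 also certifies
   [has_sup]. *)
have : has_sup [set x : K | (0 < ccdf M x)%E].
  by apply: contrapT => /sup_out; rewrite supM => /eqP; exact/negP/oner_neq0.
have t1' : 0 < 1 - t by rewrite subr_gt0.
move=> /(sup_adherent t1'); rewrite supM => -[x /= x0].
rewrite subKr => tx; apply: lt_le_trans (factor_tail_noninc (ltW tx)).
by rewrite /factor_tail -fine_ccdf fine_gt0// x0/= ltey_eq fin_num_measure.
Qed.

Lemma factor_tail_le1 t : S t <= 1.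
Proof. exact: prob_le1. Qed.

(** Continuity from above along the events [M > 1 - 1 / (n + 2)], whose intersection is null because
    [M < 1] almost surely; the shift by 2 keeps the thresholds positive. *)
Lemma factor_tail_cvg0 (e : K) : 0 < e -> exists2 c, 0 < c < 1 & S c < e.
Proof.
move=> e0; pose F (n : nat) := [set w | 1 - n.+2%:R^-1 < M w].
have mF n : measurable (F n) by exact: mMlt.
have mI : measurable (\bigcap_n F n) by exact: bigcap_measurable.
have F0 : P (\bigcap_n F n) = 0%E.
  rewrite -(probE P mI); congr EFin; apply/eqP; rewrite eq_le prob_ge0 andbT.
  rewrite (_ : 0 = prob P set0); last by rewrite /prob measure0.
  apply: prob_le_as M01 _ => // [|w [Fw /andP[_ M1]]].
    exact: measurable_set01.
  have [n nM] : exists n : nat, (1 - M w)^-1 < n%:R.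
    by exists (Num.trunc (1 - M w)^-1).+1; exact: truncnS_gt.
  have := Fw n I; rewrite /F/= ltrBlDr -ltrBlDl => h.
  have M0 : 0 < 1 - M w by rewrite subr_gt0.
  have : n.+2%:R < (1 - M w)^-1 by rewrite -[ltLHS]invrK ltf_pV2 ?posrE ?invr_gt0.
  move=> /lt_trans /(_ nM); rewrite ltr_nat => /ltnW; rewrite ltnNge leqnSn.
  by [].
have Fcvg : P (F n) @[n --> \oo] --> P (\bigcap_n F n).
  apply: (@nonincreasing_cvg_mu _ _ _ P F) => //.
    by rewrite ltey_eq fin_num_measure.
  move=> m n mn; apply/subsetPset => w; rewrite /F/=; apply: le_lt_trans.
  by rewrite lerD2l lerN2 lef_pV2 ?posrE ?ltr0n// ler_nat !ltnS.
have /fine_cvgP[_ fcvg] : P (F n) @[n --> \oo] --> 0%:E by rewrite -[0%:E]F0.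
near \oo => n; exists (1 - n.+2%:R^-1).
  rewrite subr_gt0 invf_lt1 ?ltr0n// ltr1n/= ltrBlDr ltrDl invr_gt0 ltr0n//.
by near: n; exact: (cvgr_lt _ fcvg _ e0).
Unshelve. all: by end_near.
Qed.

Lemma tail_rateE z : 1 <= z -> f z / z = - ln (S (1 - 1 / z)).
Proof.
move=> z1; have z0 : z != 0 by rewrite lt0r_neq0//; lra.
by rewrite /tail_rate z1 fine_ccdf -/(S _); field.
Qed.

Lemma factor_tail_rate_gt0 z : 1 <= z -> 0 < S (1 - 1 / z).
Proof.
by move=> z1; rewrite factor_tail_gt0// ltrBlDr ltrDl divr_gt0//; lra.
Qed.

Lemma expR_tail_rate z : 1 <= z -> expR (- (f z / z)) = S (1 - 1 / z).
Proof.
by move=> z1; rewrite tail_rateE// opprK lnK// posrE factor_tail_rate_gt0.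
Qed.

Lemma tail_rate_div_nd x y : 1 <= x -> x <= y -> f x / x <= f y / y.
Proof.
move=> x1 xy; have y1 := le_trans x1 xy.
rewrite !tail_rateE// lerN2 ler_ln ?posrE ?factor_tail_rate_gt0//.
apply: factor_tail_noninc.
by rewrite lerD2l lerN2 !div1r lef_pV2 ?posrE//; lra.
Qed.

Lemma tail_rate_div_ge0 x : 1 <= x -> 0 <= f x / x.
Proof. by move=> x1; rewrite tail_rateE// oppr_ge0 ln_le0// factor_tail_le1. Qed.

Lemma tail_rate_nd x y : x <= y -> f x <= f y.
Proof.
move=> xy; have fE z : 1 <= z -> f z = z * (f z / z).
  by move=> z1; field; rewrite lt0r_neq0//; lra.
have f0 z : z < 1 -> f z = 0 by rewrite /tail_rate ltNge => /negbTE ->.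
have [y1|y1] := ltP y 1; first by rewrite !f0// (le_lt_trans xy).
have hy := tail_rate_div_ge0 y1.
have [x1|x1] := ltP x 1.
  by rewrite f0// fE// mulr_ge0//; lra.
rewrite fE// [leRHS]fE//; apply: ler_pM => //; [lra|exact: tail_rate_div_ge0|].
exact: tail_rate_div_nd.
Qed.

Lemma tail_rate_div_oo B : \forall x \near +oo, B <= f x / x.
Proof.
have [c /andP[c0 c1] Sc] := factor_tail_cvg0 (expR_gt0 (- B)).
apply: (@near_pinfty_ge _ _ (1 + (1 - c)^-1)) => x xc.
have c0' : 0 < (1 - c)^-1 by rewrite invr_gt0; lra.
have x1 : 1 <= x by lra.
rewrite -lerN2 -ler_expR expR_tail_rate//; apply: le_trans (ltW Sc).
apply: factor_tail_noninc; rewrite div1r lerBrDr -lerBrDl.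
by rewrite -[leRHS]invrK lef_pV2 ?posrE ?invr_gt0//; lra.
Qed.

End factor_tail.

(** * Tail inequalities from the fixpoint equation *)

Section perpetuity.
Context d (T : measurableType d) (K : realType) (P : probability T K).
Variables (Q M R : {RV P >-> K}) (q : K).
Hypothesis indep : independent_of_pair R Q M.
Hypothesis fixpoint : eq_in_distribution P R (fun w => Q w + M w * R w).
Hypothesis M01 : P [set w | 0 <= M w < 1] = 1%E.
Hypothesis supM : sup [set x : K | (0 < ccdf M x)%E] = 1.
Hypothesis q_gt0 : 0 < q.
Hypothesis Qq : P [set w | Q w = q] = 1%E.

Local Notation pr := (prob P).

(** Levels are measured in units of [q], which normalises the recursion to additive term 1. *)
Definition scaled_tail (x : K) : K := pr [set w | q * x < R w].

Local Notation D := scaled_tail.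

Local Notation S := (factor_tail M).

Let N := [set w | 0 <= M w < 1] `&` [set w | Q w = q].

Let mM : measurable_fun setT M := measurable_funPT M.
Let mQ : measurable_fun setT Q := measurable_funPT Q.
Let mR : measurable_fun setT R := measurable_funPT R.
Let mMR : measurable_fun setT (fun w => M w * R w).
Proof. exact: measurable_funM. Qed.
Let mQMR : measurable_fun setT (fun w => Q w + M w * R w).
Proof. exact: measurable_funD. Qed.

Let mN : measurable N.
Proof.
apply: measurableI; first exact: measurable_set01.
by rewrite -[X in measurable X]setTI; exact: (mQ measurableT (measurable_set1 q)).
Qed.

Let PN : P N = 1%E.
Proof.
apply/eqP; rewrite eq_le probability_le1//= -M01.
have mM01 := measurable_set01 mM.
rewrite -(probE P mM01) -(probE P mN) lee_fin.
apply: prob_le_as Qq _ => //.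
by rewrite -[X in measurable X]setTI; exact: (mQ measurableT (measurable_set1 q)).
Qed.

Let mRlt t : measurable [set w | t < R w].
Proof. exact: measurable_set_lt. Qed.
Let mRgt t : measurable [set w | R w < t].
Proof. exact: measurable_set_lt. Qed.
Let mMlt t : measurable [set w | t < M w].
Proof. exact: measurable_set_lt. Qed.
Let mMRlt t : measurable [set w | t < M w * R w].
Proof. exact: measurable_set_lt. Qed.
Let mQMRlt t : measurable [set w | t < Q w + M w * R w].
Proof. exact: measurable_set_lt. Qed.

Lemma pr_indep (A B : set K) : measurable A -> measurable B ->
  pr ([set w | A (R w)] `&` [set w | B (M w)]) =
  pr [set w | A (R w)] * pr [set w | B (M w)].
Proof.
move=> mA mB; have mB2 : measurable [set z : K * K | B z.2].
  have ms : measurable_fun setT (snd : K * K -> K) by exact: measurable_snd.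
  by rewrite -[X in measurable X]setTI; exact: (ms measurableT _ mB).
have mRA : measurable [set w | A (R w)] by rewrite -[X in measurable X]setTI; exact: mR.
have mMB : measurable [set w | B (M w)] by rewrite -[X in measurable X]setTI; exact: mM.
apply: EFin_inj; rewrite EFinM !probE//; last exact: measurableI.
exact: (indep mA mB2).
Qed.

Lemma scaled_tailE x : D x = pr [set w | q * x < Q w + M w * R w].
Proof.
have mo : measurable (`]q * x, +oo[%classic : set K) by [].
have := fixpoint mo; rewrite !preimage_itvoy => h.
by rewrite /scaled_tail /prob h.
Qed.

Lemma scaled_tail_noninc x y : x <= y -> D y <= D x.
Proof.
move=> xy; apply: prob_le => // w /=; apply: le_lt_trans.
by rewrite ler_pM2l.
Qed.

Lemma scaled_tail_le1 x : D x <= 1.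
Proof. exact: prob_le1. Qed.

Lemma scaled_tail_mul x t : 0 < x -> 0 <= t -> D x * S t <= D (1 + t * x).
Proof.
move=> x0 t0; rewrite [leRHS]scaled_tailE.
have mgt (a : K) : measurable [set b : K | a < b].
  by apply: measurable_set_lt => //; exact: measurable_cst.
have := pr_indep (mgt (q * x)) (mgt t); rewrite /= -/(D x) -/(S t) => <-.
apply: (prob_le_as mN) => //; first exact: measurableI.
move=> w [[/= Rw Mw] [/andP[M0 M1] ->]].
rewrite mulrDr mulr1 ltrD2l.
apply: (@lt_le_trans _ _ (M w * (q * x))).
  by rewrite mulrCA ltr_pM2r// mulr_gt0.
by rewrite ler_wpM2l// ltW.
Qed.

(** On the slice [q * t < R <= q * s] the event forces [M > (x - 1) / s], and independence factors
    the probability. The remainder is the same event with [s] for [t], so slices can be peeled off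
    one after another. *)
Lemma scaled_tail_step x s t : 1 <= x -> 0 < s ->
  pr ([set w | q * t < R w] `&` [set w | q * (x - 1) < M w * R w]) <=
  D t * S ((x - 1) / s) +
  pr ([set w | q * s < R w] `&` [set w | q * (x - 1) < M w * R w]).
Proof.
move=> x1 s0.
have mgt (a : K) : measurable [set b : K | a < b].
  by apply: measurable_set_lt => //; exact: measurable_cst.
have := pr_indep (mgt (q * t)) (mgt ((x - 1) / s)); rewrite /= -/(D t) -/(S _) => <-.
apply: (prob_leU_as mN) => //; try exact: measurableI.
move=> w [[/= Rw MRw] [/andP[M0 M1] _]].
have [Rs|sR] := leP (R w) (q * s); [left|by right].
split => //=; rewrite ltr_pdivrMr// -(ltr_pM2l q_gt0).
apply: lt_le_trans MRw _; rewrite mulrCA; exact: ler_wpM2l.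
Qed.

(** Since [M < 1], one step gains less than one unit of level: only starting levels above [x - 1]
    matter, and slices of total height 1 reach up to [x]. *)
Lemma scaled_tail_le_joint x : 1 <= x ->
  D x <= pr ([set w | q * (x - 1) < R w] `&` [set w | q * (x - 1) < M w * R w]).
Proof.
move=> x1; rewrite [leLHS]scaled_tailE.
apply: (prob_le_as mN) => //; first exact: measurableI.
move=> w [/= h [/andP[M0 M1] Qw]]; rewrite Qw in h.
have qx : 0 <= q * (x - 1) by rewrite mulr_ge0 ?subr_ge0// ltW.
have MRw : q * (x - 1) < M w * R w by rewrite mulrBr mulr1 ltrBlDl.
split => //=; apply: lt_le_trans MRw _.
have R0 : 0 <= R w by rewrite leNgt; apply/negP => R0; nra.
by rewrite ler_piMl// ltW.
Qed.

(** When [M <= c], the old value must already exceed [q * (x - 1) / c], which for large [x] is well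
    above the target. *)
Lemma scaled_tail_split x c : 1 <= x -> 0 < c ->
  D x <= D (x - 1) * S c + D ((x - 1) / c) * (1 - S c).
Proof.
move=> x1 c0.
have mgt (a : K) : measurable [set b : K | a < b].
  by apply: measurable_set_lt => //; exact: measurable_cst.
have mle (a : K) : measurable [set b : K | b <= a].
  rewrite (_ : [set b | _] = ~` [set b : K | a < b]); first exact: measurableC.
  by apply/seteqP; split => b /=; rewrite leNgt => /negP.
have -> : 1 - S c = pr [set w | M w <= c].
  rewrite -prob_setC//; congr prob.
  by apply/seteqP; split => b /=; rewrite leNgt => /negP.
have := pr_indep (mgt (q * (x - 1))) (mgt c); rewrite /= -/(D (x - 1)) -/(S c) => <-.
have := pr_indep (mgt (q * ((x - 1) / c))) (mle c); rewrite /= -/(D _) => <-.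
apply: le_trans (scaled_tail_le_joint x1) _.
have mMle : measurable [set w | M w <= c].
  by rewrite -[X in measurable X]setTI; exact: (mM measurableT (mle c)).
apply: (prob_leU_as mN) => //; try exact: measurableI.
move=> w [[/= Rw MRw] [/andP[M0 M1] _]].
have [Mc|cM] := leP (M w) c; [right|by left].
split => //=; rewrite mulrA ltr_pdivrMr//.
have qx : 0 <= q * (x - 1) by rewrite mulr_ge0 ?subr_ge0// ltW.
apply: lt_le_trans MRw _; rewrite mulrC; apply: ler_wpM2l => //.
exact: le_trans (ltW Rw).
Qed.

(** A negative [R] satisfies [R <= M * R], so undoing one step of the recursion pushes the value
    down by a further [q]. Iteration leaves no mass below 0. *)
Lemma pr_R_lt_opp y : 0 <= y ->
  pr [set w | R w < - y] <= pr [set w | R w < - (y + q)].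
Proof.
move=> y0; have -> : pr [set w | R w < - y] = pr [set w | Q w + M w * R w < - y].
  have mo : measurable (`]-oo, (- y)[%classic : set K) by [].
  by have := fixpoint mo; rewrite !preimage_itvNyo /prob => ->.
apply: (prob_le_as mN) => //.
  exact: measurable_set_lt.
move=> w [/= h [/andP[M0 M1] Qw]]; rewrite Qw in h *.
have MR0 : M w * R w < - (y + q) by lra.
have R0 : R w < 0.
  by rewrite ltNge; apply/negP => R0; have := mulr_ge0 M0 R0; have := q_gt0; lra.
by apply: le_lt_trans MR0; have : 0 <= (1 - M w) * - R w; [apply: mulr_ge0|]; lra.
Qed.

Lemma pr_R_lt0 : pr [set w | R w < 0] = 0.
Proof.
have h (n : nat) : pr [set w | R w < 0] <= pr [set w | R w < - (n%:R * q)].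
  elim: n => [|n IH]; first by rewrite mul0r oppr0.
  rewrite -natr1 mulrDl mul1r; apply: le_trans IH _; apply: pr_R_lt_opp.
  by rewrite mulr_ge0// ltW.
apply/eqP; rewrite eq_le prob_ge0 andbT; apply/ler_addgt0Pr => e e0; rewrite add0r.
have /fine_cvgP[_ fc] : cdf R x @[x --> -oo] --> 0%:E by exact: cvg_cdfNy0.
have [B [_ HB]] := cvgr_lt _ fc _ e0.
pose n := (Num.trunc ((1 - B) / q)).+1.
apply: le_trans (h n) _.
have nB : - (n%:R * q) < B.
  by have := truncnS_gt ((1 - B) / q); rewrite -/n ltr_pdivrMr//; lra.
have cdfE : fine (cdf R (- (n%:R * q))) = pr [set w | R w <= - (n%:R * q)].
  by rewrite /prob /cdf /distribution /pushforward preimage_itvNyc.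
have := HB _ nB; rewrite /= cdfE => /ltW; apply: le_trans.
apply: prob_le => //; last by move=> w /= /ltW.
have mo : measurable (`]-oo, (- (n%:R * q))%R] : set K) by [].
by rewrite -preimage_itvNyc -[X in measurable X]setTI; exact: mR.
Qed.

(** As [R >= 0] almost surely, [q + M * R] exceeds [q / 2] almost surely. A factor above
    [1 - 1 / (2 * y)], which has positive probability, then lifts level [y] by [1 / 2]. *)
Lemma scaled_tail_gt0 x : 0 < D x.
Proof.
have half : 0 < D (1 / 2).
  rewrite [ltRHS]scaled_tailE.
  apply: (@lt_le_trans _ _ (pr (~` [set w | R w < 0]))).
    by rewrite prob_setC// pr_R_lt0 subr0.
  apply: (prob_le_as mN) => //; first exact: measurableC.
  move=> w [/= /negP]; rewrite -leNgt => R0 [/andP[M0 M1] ->].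
  by have := mulr_ge0 M0 R0; have := q_gt0; rewrite /=; lra.
have grow (n : nat) : 0 < D (1 / 2 + n%:R / 2).
  elim: n => [|n IH]; first by rewrite mul0r addr0.
  set y := _ + _ in IH.
  have y12 : 1 / 2 <= y by rewrite /y lerDl divr_ge0.
  have t0 : 0 <= 1 - (2 * y)^-1 by rewrite subr_ge0 invf_le1; lra.
  have y0 : 0 < y by lra.
  have tE : 1 + (1 - (2 * y)^-1) * y = 1 / 2 + n.+1%:R / 2.
    have yV : (2 * y)^-1 * y = 1 / 2 by field; rewrite lt0r_neq0.
    by rewrite mulrBl yV -[n.+1%:R]natr1 /y; lra.
  rewrite -tE; apply: lt_le_trans (scaled_tail_mul y0 t0).
  rewrite mulr_gt0// factor_tail_gt0// ltrBlDr ltrDl invr_gt0; lra.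
apply: lt_le_trans (grow (Num.trunc (2 * x)).+1) _.
by apply: scaled_tail_noninc; have := truncnS_gt (2 * x); lra.
Qed.

Lemma scaled_tail_cvg0 (e : K) : 0 < e -> \forall x \near +oo, D x <= e.
Proof.
move=> e0; have /fine_cvgP[_ fc] : ccdf R x @[x --> +oo] --> 0%:E by exact: cvg_ccdfy0.
have [X X1 HX] := near_pinfty_ex (cvgr_le _ fc _ e0).
apply: (@near_pinfty_ge _ _ (X / q)) => x xX.
rewrite /scaled_tail -fine_ccdf; apply: HX.
by rewrite mulrC -ler_pdivrMr.
Qed.

(* With [p = P(M > c)] small, [D (y + 1) <= p D y + (1 - p) D (y + 2)] for large
   [y]; summing over [y = x, x + 1, ...] telescopes to
   [(1 - p) D (x + 1) <= p D x]. *)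
Lemma scaled_tail_decay : \forall x \near +oo, D (x + 1) <= D x / 4.
Proof.
(* For [p < 1 / 5] the ratio [p / (1 - p)] is below [1 / 4]. *)
have lt15 : 0 < 1 / 5 :> K by lra.
have [c /andP[c0 c1] Sc] := factor_tail_cvg0 M01 lt15.
apply: (@near_pinfty_ge _ _ (2 / (1 - c) + 1)) => x xc.
have c2 : 0 < 2 / (1 - c) by rewrite divr_gt0//; lra.
have xc2 : 2 <= x * (1 - c) by rewrite -ler_pdivrMr//; lra.
have p0 : 0 <= S c by exact: prob_ge0.
have split y : x <= y -> D (y + 1) <= D y * S c + D (y + 1 + 1) * (1 - S c).
  move=> xy; have := @scaled_tail_split (y + 1) c; rewrite addrK.
  have y1 : 1 <= y + 1 by lra.
  move=> /(_ y1 c0) /le_trans; apply; rewrite lerD2l; apply: ler_wpM2r.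
    by rewrite subr_ge0 factor_tail_le1.
  apply: scaled_tail_noninc; rewrite ler_pdivlMr//; nra.
have tel (n : nat) : (1 - S c) * (D (x + 1) - D (x + 1 + n%:R)) <=
    S c * (D x - D (x + n%:R)).
  elim: n => [|n IH]; first by rewrite !addr0 !subrr !mulr0.
  have := split (x + n%:R); rewrite lerDl ler0n => /(_ isT).
  rewrite -[n.+1%:R]natr1 !addrA; move: IH; rewrite (addrAC x 1); lra.
have Dx0 := scaled_tail_gt0 x; have Dx1 := scaled_tail_gt0 (x + 1).
rewrite leNgt; apply/negP => lt4.
have e0 : 0 < (D (x + 1) - D x / 4) / 2 by lra.
have [Y Y1 HY] := near_pinfty_ex (scaled_tail_cvg0 e0).
have := tel (Num.trunc Y).+1; set n := _.+1.
have : D (x + 1 + n%:R) <= (D (x + 1) - D x / 4) / 2.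
  by apply: HY; have := truncnS_gt Y; rewrite -/n; lra.
have := scaled_tail_gt0 (x + n%:R).
have := scaled_tail_gt0 (x + 1 + n%:R).
set a := D (x + 1 + _); set b := D (x + n%:R).
move: Dx0 Dx1 lt4 p0 Sc; rewrite -/(D x) -/(D (x + 1)) -/(S c).
nra.
Qed.

Local Notation f := (tail_rate M).

Lemma scaled_tail_climb y dl : 1 <= y -> 0 < dl < 1 ->
  D y * expR (- (f (y / (1 - dl)) / (y / (1 - dl)))) <= D (y + dl).
Proof.
move=> y1 /andP[d0 d1]; have d1' : 0 < 1 - dl by lra.
have y0 : 0 < y by lra.
rewrite (expR_tail_rate supM); last by rewrite ler_pdivlMr//; lra.
have -> : 1 / (y / (1 - dl)) = (1 - dl) / y by rewrite div1r invf_div.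
have -> : y + dl = 1 + (1 - (1 - dl) / y) * y.
  by rewrite mulrBl divfK ?lt0r_neq0//; lra.
by apply: scaled_tail_mul => //; rewrite subr_ge0 ler_pdivrMr//; lra.
Qed.

(** After the [n] slices between [y - 1] and [y] there remain the starts above [y]. Those up to
    [y + 1] need a factor above [(y - 1) / (y + 1) >= c] and contribute at most [D y / 4]; those
    beyond contribute at most [D (y + 1) <= D y / 4]. Absorbing [D y / 2] on the left gives the
    factor 2. *)
Lemma scaled_tail_one_step : \forall y \near +oo, one_step_bound D f y.
Proof.
have [X X1 decay] := near_pinfty_ex scaled_tail_decay.
have lt14 : 0 < 1 / 4 :> K by lra.
have [c /andP[c0 c1] Sc] := factor_tail_cvg0 M01 lt14.
have c2 : 0 < 2 / (1 - c) by rewrite divr_gt0//; lra.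
apply: (@near_pinfty_ge _ _ (X + 2 / (1 - c))) => y yX n n0.
have y1 : 1 <= y by lra.
have yc : 2 <= y * (1 - c) by rewrite -ler_pdivrMr//; lra.
have n0' : 0 < n%:R :> K by rewrite ltr0n.
pose E t := pr ([set w | q * t < R w] `&` [set w | q * (y - 1) < M w * R w]).
pose z (j : nat) : K := (y - j%:R / n%:R) / (1 - j%:R / n%:R).
have Ele (m : nat) : (m <= n)%N -> E (y - m%:R / n%:R) <=
    \sum_(j < m) D (y - j.+1%:R / n%:R) * expR (- (f (z j) / z j)) + E y.
  elim: m => [_|m IH mn]; first by rewrite mul0r subr0 big_ord0 add0r.
  have d1 : m%:R / n%:R < 1 :> K by rewrite ltr_pdivrMr// mul1r ltr_nat.
  have d0 : 0 <= m%:R / n%:R :> K by rewrite divr_ge0.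
  have s0 : 0 < y - m%:R / n%:R by lra.
  have d1' : 0 < 1 - m%:R / n%:R :> K by lra.
  apply: le_trans (scaled_tail_step _ y1 s0) _.
  rewrite big_ord_recr/= [X in _ <= X + _]addrC -addrA.
  apply: lerD; last exact: IH (ltnW mn).
  rewrite (expR_tail_rate supM); last by rewrite /z ler_pdivlMr//; lra.
  rewrite (_ : 1 - 1 / z m = (y - 1) / (y - m%:R / n%:R))//.
  rewrite /z div1r invf_div; move: s0; set e := m%:R / n%:R => s0.
  by field; rewrite lt0r_neq0.
have En : D y <= E (y - n%:R / n%:R).
  by rewrite mulfV ?lt0r_neq0//; exact: scaled_tail_le_joint.
have Ey : E y <= D y * (1 / 4) + D y / 4.
  have s0 : 0 < y + 1 by lra.
  apply: le_trans (scaled_tail_step y y1 s0) _; apply: lerD.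
    rewrite ler_pM2l ?scaled_tail_gt0//; apply: le_trans (ltW Sc).
    by apply: factor_tail_noninc; rewrite ler_pdivlMr//; lra.
  apply: (@le_trans _ _ (D (y + 1))); last by apply: decay; lra.
  by apply: prob_le; [exact: measurableI|exact: mRlt|move=> w []].
have := Ele n (leqnn n); rewrite -/(z _) /=; lra.
Qed.

End perpetuity.

Theorem theorem4p1 (K : realType) (d : measure_display) (T : measurableType d)
    (P : probability T K) (Q M R : {RV P >-> K}) (q : K)
    (indep : independent_of_pair R Q M)
    (fixpoint : eq_in_distribution P R (fun w => Q w + M w * R w))
    (M01 : P [set w | 0 <= M w < 1] = 1%E)
    (supM : sup [set x : K | (0 < ccdf M x)%E] = 1)
    (q_gt0 : 0 < q)
    (Qq : P [set w | Q w = q] = 1%E) :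
  let f := tail_rate M in
  [/\ forall rstar r : K, 1 < rstar -> 1 / r + 1 / rstar = 1 ->
        regularly_varying rstar f ->
        ln (fine (ccdf R x)) / f (x / q) @[x --> +oo]
          --> - (r `^ (rstar - 1)),
      class_Gamma f ->
        ln (fine (ccdf R x)) / f (x / q) @[x --> +oo] --> - expR 1
    & regularly_varying 1 f -> ultimately_strictly_convex f ->
        ln (fine (ccdf R x)) / f (x / q) @[x --> +oo] --> (-1 : K)].
Proof.
move=> f; pose D := scaled_tail R q.
have D0 x : 0 < D x by exact: (scaled_tail_gt0 indep fixpoint M01 supM q_gt0 Qq).
have D1 x : D x <= 1 by exact: scaled_tail_le1.
have Dni x y : x <= y -> D y <= D x by exact: scaled_tail_noninc.
have Dcl := scaled_tail_climb indep fixpoint M01 supM q_gt0 Qq.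
have Dos := scaled_tail_one_step indep fixpoint M01 supM q_gt0 Qq.
have fnd := tail_rate_nd supM.
have phind := tail_rate_div_nd supM.
have phioo := tail_rate_div_oo M01 supM.
have rescale (l : K) : ln (D y) / f y @[y --> +oo] --> l ->
    ln (fine (ccdf R x)) / f (x / q) @[x --> +oo] --> l.
  move=> Dl; have xq : x / q @[x --> +oo] --> +oo.
    by apply: gt0_cvgMly => //; rewrite invr_gt0.
  apply: cvg_trans (cvg_comp _ _ xq Dl); apply: near_eq_cvg; near=> x.
  by rewrite /= fine_ccdf /D /scaled_tail [q * _]mulrC divfK// lt0r_neq0.
split.
- move=> p r p1 rp [_ _ fcvg]; apply: rescale.
  have p0 : 0 < p by lra.
  have [r0 _] := conjugate_exponent p1 rp.
  have -> : r `^ (p - 1) = p * r `^ (p - 1) / p.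
    by rewrite [p * _]mulrC mulfK// lt0r_neq0.
  apply: (tail_limit_regularly_varying D0 D1 Dni Dcl Dos fnd phind phioo) => //.
  + by rewrite mulr_gt0// powR_gt0.
  + exact: ltW.
  + by move=> w; exact: powR_ge_linear.
  + move=> A' hA; exists (p - 1)^-1; first by rewrite invr_gt0 subr_gt0.
    by rewrite (powR_linear_eq p1 rp).
- move=> [_ _ [g [_ g0 fcvg]]]; apply: rescale.
  exact: (tail_limit_gamma D0 D1 Dni Dcl Dos fnd phind phioo g0).
- move=> [_ _ fcvg] _; apply: rescale.
  rewrite -[1 in X in _ --> X]divr1.
  apply: (tail_limit_regularly_varying D0 D1 Dni Dcl Dos fnd phind phioo) => //.
  + by move=> w w0; rewrite powRr1; lra.
  (* The infimum 1 of [(1 + w) / w = 1 + 1 / w] is not attained; this [w] gives the midpoint of 1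
     and [A']. *)
  + move=> A' A1; have h : 0 < 2 / (A' - 1) by rewrite divr_gt0//; lra.
    exists (2 / (A' - 1)) => //; rewrite powRr1; last lra.
    rewrite ltr_pdivrMr//.
    have : 2 / (A' - 1) * (A' - 1) = 2 by rewrite divfK// lt0r_neq0//; lra.
    by lra.
Unshelve. all: by end_near.
Qed.
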